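(* Let $\mathcal{B}$ be a category with finite limits, let $T=(T,m,e)$ be a cartesian monad on $\mathcal{B}$, and let $p\colon x\to z$ be a functor of $T$-multicategories internal to $\mathcal{B}$. If $Tp_1$ is an effective descent morphism in $\mathcal{B}$, $Tp_2$ is a descent morphism in $\mathcal{B}$, and $p_3$ is an almost descent morphism in $\mathcal{B}$, then $p$ is an effective descent morphism in $\mathsf{Cat}(T,\mathcal{B})$.
   Context: **Descent.** Let $p\colon x\to y$ be a morphism in a category $\mathcal{C}$ such that pullbacks along $p$ exist. The change-of-base functor $p^*\colon \mathcal{C}/y\to\mathcal{C}/x$ is right adjoint to $p_!=p\circ -$. Let $\mathsf{Desc}(p)$ be the category of algebras for the monad $p^*p_!$ and $\mathcal{K}^p\colon\mathcal{C}/y\to\mathsf{Desc}(p)$ the Eilenberg–Moore comparison functor. The morphism $p$ is an almost descent morphism if $\mathcal{K}^p$ is faithful, a descent morphism if $\mathcal{K}^p$ is fully faithful, and an effective descent morphism if $\mathcal{K}^p$ is an equivalence. **Cartesian monads.** A monad $T=(T,m,e)$ (multiplication $m$, unit $e$) is cartesian if $T$ preserves pullbacks and all naturality squares of $m$ and $e$ are pullbacks. **Internal $T$-multicategories.** A $T$-multicategory $x$ internal to $\mathcal{B}$ consists of objects $x_0,x_1$, morphisms $d_1\colon x_1\to Tx_0$ and $d_0\colon x_1\to x_0$, a pullback $x_2$ of $d_1\colon x_1\to Tx_0$ and $Td_0\colon Tx_1\to Tx_0$ with projections $d_0\colon x_2\to x_1$, $d_2\colon x_2\to Tx_1$, a composition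 $d_1\colon x_2\to x_1$ with $d_1 d_1=m_{x_0}\,Td_1\,d_2$ and $d_0d_1=d_0d_0$, and a unit $s_0\colon x_0\to x_1$ with $d_1s_0=e_{x_0}$ and $d_0s_0=\mathrm{id}$; let $x_3$ be the pullback of $d_2\colon x_2\to Tx_1$ and $Td_0\colon Tx_2\to Tx_1$, with projections $d_0\colon x_3\to x_2$, $d_3\colon x_3\to Tx_2$. Writing $(g,f)\colon a\to x_2$ for the morphism induced by $g\colon a\to x_1$, $f\colon a\to Tx_1$ with $d_1g=(Td_0)f$, put $s_0=(\mathrm{id},Ts_0\,d_1)$, $s_1=(s_0d_0,e_{x_1})\colon x_1\to x_2$ and $d_1=(d_0d_0,Td_1\,d_3)$, $d_2=(d_1d_0,m_{x_1}\,Td_2\,d_3)\colon x_3\to x_2$. The axioms are $d_1s_0=\mathrm{id}=d_1s_1\colon x_1\to x_1$ (identity) and $d_1d_1=d_1d_2\colon x_3\to x_1$ (associativity). A functor $p\colon x\to y$ of $T$-multicategories is a pair $p_0\colon x_0\to y_0$, $p_1\colon x_1\to y_1$ with $d_0p_1=p_0d_0$, $d_1p_1=(Tp_0)d_1$, $p_1s_0=s_0p_0$, and $p_1d_1=d_1p_2$ on $x_2$, where $p_2\colon x_2\to y_2$ is induced on pullbacks by $p_1$ and $Tp_1$. Similarly $p_3\colon x_3\to y_3$ is induced by $p_2$ and $Tp_2$. These form the category $\mathsf{Cat}(T,\mathcal{B})$. *)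

(* Defs.v *)
From Stdlib Require Import ProofIrrelevance IndefiniteDescription FinFun.
From mathcomp Require Import ssreflect ssrfun ssrbool.

Set Implicit Arguments.
Unset Strict Implicit.
Unset Printing Implicit Defensive.

Declare Scope cat_scope.
Delimit Scope cat_scope with cat.
Local Open Scope cat_scope.
#[local] Obligation Tactic := idtac.

Reserved Notation "a ~> b" (at level 90, b at level 89, no associativity).
Reserved Notation "g ∘ f" (at level 40, left associativity).

Record Category := {
  obj :> Type;
  hom : obj -> obj -> Type;
  id : forall a, hom a a;
  comp : forall a b c, hom b c -> hom a b -> hom a c;
  comp_idl : forall a b (f : hom a b), comp (id b) f = f;
  comp_idr : forall a b (f : hom a b), comp f (id a) = f;
  comp_assoc : forall a b c d (h : hom c d) (g : hom b c) (f : hom a b),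
    comp h (comp g f) = comp (comp h g) f
}.
Arguments hom {C} a b : rename.
Arguments id {C} a : rename.
Arguments comp {C a b c} g f : rename.
Notation "a ~> b" := (hom a b) : cat_scope.
Notation "g ∘ f" := (comp g f) : cat_scope.

Record Functor (C D : Category) := {
  fobj :> C -> D;
  fmap : forall a b, (a ~> b) -> (fobj a ~> fobj b);
  fmap_id : forall a, fmap (id a) = id (fobj a);
  fmap_comp : forall a b c (g : b ~> c) (f : a ~> b),
    fmap (g ∘ f) = fmap g ∘ fmap f
}.
Arguments fmap {C D} F {a b} f : rename.

Definition FId (C : Category) : Functor C C :=
  {| fobj := fun a => a; fmap := fun a b f => f;
     fmap_id := fun a => erefl; fmap_comp := fun a b c g f => erefl |}.

Program Definition FComp (C D E : Category) (G : Functor D E) (F : Functor C D) :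
  Functor C E := {| fobj := fun a => G (F a); fmap := fun a b f => fmap G (fmap F f) |}.
Next Obligation. by move=> * /=; rewrite !fmap_id. Qed.
Next Obligation. by move=> * /=; rewrite !fmap_comp. Qed.

Record NatTrans (C D : Category) (F G : Functor C D) := {
  nt :> forall a, F a ~> G a;
  nt_natural : forall a b (f : a ~> b), nt b ∘ fmap F f = fmap G f ∘ nt a
}.

Definition is_iso (C : Category) (a b : C) (f : a ~> b) : Prop :=
  exists g : b ~> a, g ∘ f = id a /\ f ∘ g = id b.

Definition naturally_isomorphic (C D : Category) (F G : Functor C D) : Prop :=
  exists t : NatTrans F G, forall a, is_iso (t a).

Definition faithful (C D : Category) (F : Functor C D) : Prop :=
  forall (a b : C) (f g : a ~> b), fmap F f = fmap F g -> f = g.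

Definition full (C D : Category) (F : Functor C D) : Prop :=
  forall (a b : C) (h : F a ~> F b), exists f : a ~> b, fmap F f = h.

Definition fully_faithful (C D : Category) (F : Functor C D) : Prop :=
  full F /\ faithful F.

Definition is_equivalence (C D : Category) (F : Functor C D) : Prop :=
  exists G : Functor D C,
    naturally_isomorphic (FComp G F) (FId C) /\
    naturally_isomorphic (FComp F G) (FId D).

Record Cone (J C : Category) (D : Functor J C) := {
  apex : C;
  leg : forall j, apex ~> D j;
  leg_natural : forall i j (u : i ~> j), fmap D u ∘ leg i = leg j
}.

Definition is_limit (J C : Category) (D : Functor J C) (L : Cone D) : Prop :=
  forall K : Cone D, exists! h : apex K ~> apex L, forall j, leg L j ∘ h = leg K j.

Definition finite_category (J : Category) : Prop :=
  Finite J /\ forall i j : J, Finite (i ~> j).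

Definition has_finite_limits (C : Category) : Prop :=
  forall J, finite_category J ->
  forall D : Functor J C, exists L : Cone D, is_limit L.

Definition is_pullback (C : Category) (a b c q : C)
    (f : a ~> c) (g : b ~> c) (u : q ~> a) (v : q ~> b) : Prop :=
  f ∘ u = g ∘ v /\
  forall w (s : w ~> a) (t : w ~> b), f ∘ s = g ∘ t ->
    exists! h : w ~> q, u ∘ h = s /\ v ∘ h = t.

Record Pullback (C : Category) (a b c : C) (f : a ~> c) (g : b ~> c) := {
  pb_obj :> C;
  pb_fst : pb_obj ~> a;
  pb_snd : pb_obj ~> b;
  pb_is_pullback : is_pullback f g pb_fst pb_snd
}.

Section PullbackTheory.
Variables (C : Category) (a b c : C) (f : a ~> c) (g : b ~> c) (P : Pullback f g).

Lemma pb_comm : f ∘ pb_fst P = g ∘ pb_snd P.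
Proof. exact: (pb_is_pullback P).1. Qed.

Definition pb_lift w (s : w ~> a) (t : w ~> b) (e : f ∘ s = g ∘ t) : w ~> P :=
  proj1_sig (constructive_definite_description _ ((pb_is_pullback P).2 w s t e)).

Lemma pb_fst_lift w (s : w ~> a) (t : w ~> b) (e : f ∘ s = g ∘ t) :
  pb_fst P ∘ pb_lift e = s.
Proof. by rewrite /pb_lift; case: constructive_definite_description => h []. Qed.

Lemma pb_snd_lift w (s : w ~> a) (t : w ~> b) (e : f ∘ s = g ∘ t) :
  pb_snd P ∘ pb_lift e = t.
Proof. by rewrite /pb_lift; case: constructive_definite_description => h []. Qed.

Lemma pb_ext w (h k : w ~> P) :
  pb_fst P ∘ h = pb_fst P ∘ k -> pb_snd P ∘ h = pb_snd P ∘ k -> h = k.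
Proof.
move=> e1 e2.
have e : f ∘ (pb_fst P ∘ k) = g ∘ (pb_snd P ∘ k) by rewrite !comp_assoc pb_comm.
case: ((pb_is_pullback P).2 w _ _ e) => l [_ uniq_l].
by rewrite -(uniq_l h) ?(uniq_l k).
Qed.

End PullbackTheory.

Record Monad (C : Category) := {
  mon :> Functor C C;
  mon_mult : NatTrans (FComp mon mon) mon;
  mon_unit : NatTrans (FId C) mon;
  mult_unitl : forall a, mon_mult a ∘ mon_unit (mon a) = id (mon a);
  mult_unitr : forall a, mon_mult a ∘ fmap mon (mon_unit a) = id (mon a);
  mult_assoc : forall a, mon_mult a ∘ mon_mult (mon a) = mon_mult a ∘ fmap mon (mon_mult a)
}.

Definition preserves_pullbacks (C D : Category) (F : Functor C D) : Prop :=
  forall (a b c q : C) (f : a ~> c) (g : b ~> c) (u : q ~> a) (v : q ~> b),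
    is_pullback f g u v -> is_pullback (fmap F f) (fmap F g) (fmap F u) (fmap F v).

Definition cartesian_nt (C D : Category) (F G : Functor C D) (t : NatTrans F G) : Prop :=
  forall (a b : C) (f : a ~> b), is_pullback (t b) (fmap G f) (fmap F f) (t a).

Definition cartesian_monad (C : Category) (T : Monad C) : Prop :=
  [/\ preserves_pullbacks T, cartesian_nt (mon_mult T) & cartesian_nt (mon_unit T)].

Record Algebra (C : Category) (T : Monad C) := {
  carrier : C;
  act : T carrier ~> carrier;
  act_unit : act ∘ mon_unit T carrier = id carrier;
  act_mult : act ∘ mon_mult T carrier = act ∘ fmap T act
}.

Record AlgebraHom (C : Category) (T : Monad C) (A B : Algebra T) := {
  alg_hom :> carrier A ~> carrier B;
  alg_hom_act : alg_hom ∘ act A = act B ∘ fmap T alg_hom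
}.

Lemma alg_hom_eq (C : Category) (T : Monad C) (A B : Algebra T) (f g : AlgebraHom A B) :
  alg_hom f = alg_hom g -> f = g.
Proof. by case: f g => f hf [g hg] /= e; case: _ / e hg => hg; rewrite (proof_irrelevance _ hf hg). Qed.

Program Definition EilenbergMoore (C : Category) (T : Monad C) : Category :=
  {| obj := Algebra T;
     hom := @AlgebraHom C T;
     id := fun A => {| alg_hom := id (carrier A) |};
     comp := fun A B D g f => {| alg_hom := alg_hom g ∘ alg_hom f |} |}.
Next Obligation. by move=> * /=; rewrite fmap_id comp_idl comp_idr. Qed.
Next Obligation.
by move=> * /=; rewrite fmap_comp -comp_assoc alg_hom_act !comp_assoc alg_hom_act.
Qed.
Next Obligation. by move=> *; apply: alg_hom_eq; apply: comp_idl. Qed.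
Next Obligation. by move=> *; apply: alg_hom_eq; apply: comp_idr. Qed.
Next Obligation. by move=> *; apply: alg_hom_eq; apply: comp_assoc. Qed.

Record Adjunction (C D : Category) (L : Functor C D) (R : Functor D C) := {
  adj_unit : NatTrans (FId C) (FComp R L);
  adj_counit : NatTrans (FComp L R) (FId D);
  adj_triangle_l : forall c, adj_counit (L c) ∘ fmap L (adj_unit c) = id (L c);
  adj_triangle_r : forall d, fmap R (adj_counit d) ∘ adj_unit (R d) = id (R d)
}.

Section AdjunctionMonad.
Variables (C D : Category) (L : Functor C D) (R : Functor D C) (A : Adjunction L R).

Program Definition adj_mult : NatTrans (FComp (FComp R L) (FComp R L)) (FComp R L) :=
  {| nt := fun c => fmap R (adj_counit A (L c)) |}.
Next Obligation.
move=> a b f /=; rewrite -!fmap_comp; congr fmap.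
exact: (nt_natural (adj_counit A) (fmap L f)).
Qed.

Program Definition adj_monad : Monad C :=
  {| mon := FComp R L; mon_mult := adj_mult; mon_unit := adj_unit A |}.
Next Obligation. by move=> a /=; apply: adj_triangle_r. Qed.
Next Obligation. by move=> a /=; rewrite -fmap_comp adj_triangle_l fmap_id. Qed.
Next Obligation.
move=> a /=; rewrite -!fmap_comp; congr fmap.
exact/esym/(nt_natural (adj_counit A) (adj_counit A (L a))).
Qed.

Program Definition em_comparison : Functor D (EilenbergMoore adj_monad) :=
  {| fobj := fun d => {| carrier := R d; act := fmap R (adj_counit A d) |} : EilenbergMoore adj_monad;
     fmap := fun a b f => {| alg_hom := fmap R f |} |}.
Next Obligation. by move=> d /=; apply: adj_triangle_r. Qed.
Next Obligation.
move=> d /=; rewrite -!fmap_comp; congr fmap.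
exact/esym/(nt_natural (adj_counit A) (adj_counit A d)).
Qed.
Next Obligation.
move=> a b f /=; rewrite -!fmap_comp; congr fmap.
exact/esym/(nt_natural (adj_counit A) f).
Qed.
Next Obligation. by move=> a; apply: alg_hom_eq => /=; apply: fmap_id. Qed.
Next Obligation. by move=> a b c g f; apply: alg_hom_eq => /=; apply: fmap_comp. Qed.

End AdjunctionMonad.

Record SliceObj (C : Category) (y : C) := {
  sl_obj :> C;
  sl_map : sl_obj ~> y
}.

Record SliceHom (C : Category) (y : C) (a b : SliceObj y) := {
  sl_hom :> sl_obj a ~> sl_obj b;
  sl_hom_map : sl_map b ∘ sl_hom = sl_map a
}.

Lemma sl_hom_eq (C : Category) (y : C) (a b : SliceObj y) (f g : SliceHom a b) :
  sl_hom f = sl_hom g -> f = g.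
Proof. by case: f g => f hf [g hg] /= e; case: _ / e hg => hg; rewrite (proof_irrelevance _ hf hg). Qed.

Program Definition Slice (C : Category) (y : C) : Category :=
  {| obj := SliceObj y;
     hom := @SliceHom C y;
     id := fun a => {| sl_hom := id (sl_obj a) |};
     comp := fun a b c g f => {| sl_hom := sl_hom g ∘ sl_hom f |} |}.
Next Obligation. by move=> *; rewrite comp_idr. Qed.
Next Obligation. by move=> *; rewrite comp_assoc !sl_hom_map. Qed.
Next Obligation. by move=> *; apply: sl_hom_eq; apply: comp_idl. Qed.
Next Obligation. by move=> *; apply: sl_hom_eq; apply: comp_idr. Qed.
Next Obligation. by move=> *; apply: sl_hom_eq; apply: comp_assoc. Qed.

(* A choice of a pullback of every morphism along [p]. *)
Definition pullbacks_along (C : Category) (x y : C) (p : x ~> y) : Type :=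
  forall (w : C) (f : w ~> y), Pullback f p.

Section Descent.
Variables (C : Category) (x y : C) (p : x ~> y).

Program Definition postcomp : Functor (Slice x) (Slice y) :=
  {| fobj := fun a => {| sl_obj := sl_obj a; sl_map := p ∘ sl_map a |} : Slice y;
     fmap := fun a b f => {| sl_hom := sl_hom f |} |}.
Next Obligation. by move=> a b f; rewrite /= -comp_assoc sl_hom_map. Qed.
Next Obligation. by move=> a; apply: sl_hom_eq. Qed.
Next Obligation. by move=> a b c g f; apply: sl_hom_eq. Qed.

Variable P : pullbacks_along p.

Lemma base_change_hom_subproof (a b : Slice y) (f : a ~> b) :
  sl_map b ∘ (sl_hom f ∘ pb_fst (P (sl_map a))) = p ∘ pb_snd (P (sl_map a)).
Proof. by rewrite comp_assoc sl_hom_map pb_comm. Qed.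

Program Definition base_change : Functor (Slice y) (Slice x) :=
  {| fobj := fun a => {| sl_obj := P (sl_map a); sl_map := pb_snd (P (sl_map a)) |} : Slice x;
     fmap := fun a b f =>
       {| sl_hom := pb_lift (P (sl_map b)) (base_change_hom_subproof f) |} |}.
Next Obligation. by move=> a b f /=; rewrite pb_snd_lift. Qed.
Next Obligation.
move=> a; apply: sl_hom_eq; apply: pb_ext => /=.
  by rewrite pb_fst_lift comp_idl comp_idr.
by rewrite pb_snd_lift comp_idr.
Qed.
Next Obligation.
move=> a b c g f; apply: sl_hom_eq; apply: pb_ext => /=.
  by rewrite pb_fst_lift comp_assoc pb_fst_lift -!comp_assoc pb_fst_lift.
by rewrite pb_snd_lift comp_assoc !pb_snd_lift.
Qed.

Lemma base_change_unit_subproof (a : Slice x) :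
  (p ∘ sl_map a) ∘ id (sl_obj a) = p ∘ sl_map a.
Proof. by rewrite comp_idr. Qed.

Program Definition base_change_unit : NatTrans (FId (Slice x)) (FComp base_change postcomp) :=
  {| nt := fun a => {| sl_hom := pb_lift (P (p ∘ sl_map a)) (base_change_unit_subproof a) |} |}.
Next Obligation. by move=> a /=; rewrite pb_snd_lift. Qed.
Next Obligation.
move=> a b f; apply: sl_hom_eq; apply: pb_ext => /=.
  by rewrite !comp_assoc !pb_fst_lift -comp_assoc pb_fst_lift comp_idl comp_idr.
by rewrite !comp_assoc !pb_snd_lift sl_hom_map.
Qed.

Program Definition base_change_counit : NatTrans (FComp postcomp base_change) (FId (Slice y)) :=
  {| nt := fun a => {| sl_hom := pb_fst (P (sl_map a)) |} |}.
Next Obligation. by move=> a /=; apply: pb_comm. Qed.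
Next Obligation. by move=> a b f; apply: sl_hom_eq => /=; apply: pb_fst_lift. Qed.

Program Definition base_change_adjunction : Adjunction postcomp base_change :=
  {| adj_unit := base_change_unit; adj_counit := base_change_counit |}.
Next Obligation. by move=> a; apply: sl_hom_eq => /=; apply: pb_fst_lift. Qed.
Next Obligation.
move=> a; apply: sl_hom_eq; apply: pb_ext => /=.
  by rewrite comp_assoc pb_fst_lift -comp_assoc pb_fst_lift.
by rewrite comp_assoc !pb_snd_lift comp_idr.
Qed.

Definition Desc : Category := EilenbergMoore (adj_monad base_change_adjunction).

Definition descent_comparison : Functor (Slice y) Desc :=
  em_comparison base_change_adjunction.

End Descent.

(* The properties below do not depend on the choice [P], because base change
   functors for different choices are canonically isomorphic; that some [P]
   exists is part of each property. *)
Definition almost_descent (C : Category) (x y : C) (p : x ~> y) : Prop :=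
  exists P : pullbacks_along p, faithful (descent_comparison P).

Definition descent (C : Category) (x y : C) (p : x ~> y) : Prop :=
  exists P : pullbacks_along p, fully_faithful (descent_comparison P).

Definition effective_descent (C : Category) (x y : C) (p : x ~> y) : Prop :=
  exists P : pullbacks_along p, is_equivalence (descent_comparison P).

(* In the names below [di_n] and [si_n] are the maps d_i and s_i with
   domain x_n.  The pullbacks x_2 and x_3 are part of the data. *)

Section Multicategories.
Variables (B : Category) (T : Monad B).

Record PreMulticategory := {
  ob0 : B;
  ob1 : B;
  d1_1 : ob1 ~> T ob0;
  d0_1 : ob1 ~> ob0;
  pb2 : Pullback d1_1 (fmap T d0_1);
  d1_2 : pb2 ~> ob1;
  d1_1_d1_2 : d1_1 ∘ d1_2 = mon_mult T ob0 ∘ fmap T d1_1 ∘ pb_snd pb2;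
  d0_1_d1_2 : d0_1 ∘ d1_2 = d0_1 ∘ pb_fst pb2;
  s0_0 : ob0 ~> ob1;
  d1_1_s0_0 : d1_1 ∘ s0_0 = mon_unit T ob0;
  d0_1_s0_0 : d0_1 ∘ s0_0 = id ob0;
  pb3 : Pullback (pb_snd pb2) (fmap T (pb_fst pb2))
}.

Definition ob2 (x : PreMulticategory) : B := pb2 x.
Definition ob3 (x : PreMulticategory) : B := pb3 x.
Definition d0_2 (x : PreMulticategory) : ob2 x ~> ob1 x := pb_fst (pb2 x).
Definition d2_2 (x : PreMulticategory) : ob2 x ~> T (ob1 x) := pb_snd (pb2 x).
Definition d0_3 (x : PreMulticategory) : ob3 x ~> ob2 x := pb_fst (pb3 x).
Definition d3_3 (x : PreMulticategory) : ob3 x ~> T (ob2 x) := pb_snd (pb3 x).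

Section Structure.
Variable x : PreMulticategory.

Lemma pb2_comm : d1_1 x ∘ d0_2 x = fmap T (d0_1 x) ∘ d2_2 x.
Proof. exact: pb_comm. Qed.

Lemma pb3_comm : d2_2 x ∘ d0_3 x = fmap T (d0_2 x) ∘ d3_3 x.
Proof. exact: (pb_comm (pb3 x)). Qed.

Lemma s0_1_subproof :
  d1_1 x ∘ id (ob1 x) = fmap T (d0_1 x) ∘ (fmap T (s0_0 x) ∘ d1_1 x).
Proof. by rewrite comp_assoc -fmap_comp d0_1_s0_0 fmap_id comp_idl comp_idr. Qed.

Definition s0_1 : ob1 x ~> ob2 x := pb_lift (pb2 x) s0_1_subproof.

Lemma s1_1_subproof :
  d1_1 x ∘ (s0_0 x ∘ d0_1 x) = fmap T (d0_1 x) ∘ mon_unit T (ob1 x).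
Proof. by rewrite comp_assoc d1_1_s0_0; apply: (nt_natural (mon_unit T)). Qed.

Definition s1_1 : ob1 x ~> ob2 x := pb_lift (pb2 x) s1_1_subproof.

Lemma d1_3_subproof :
  d1_1 x ∘ (d0_2 x ∘ d0_3 x) = fmap T (d0_1 x) ∘ (fmap T (d1_2 x) ∘ d3_3 x).
Proof.
rewrite comp_assoc pb2_comm -comp_assoc pb3_comm !comp_assoc -!fmap_comp.
by congr (fmap T _ ∘ _); rewrite d0_1_d1_2.
Qed.

Definition d1_3 : ob3 x ~> ob2 x := pb_lift (pb2 x) d1_3_subproof.

Lemma d2_3_subproof :
  d1_1 x ∘ (d1_2 x ∘ d0_3 x) =
  fmap T (d0_1 x) ∘ (mon_mult T (ob1 x) ∘ fmap T (d2_2 x) ∘ d3_3 x).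
Proof.
rewrite comp_assoc d1_1_d1_2 -/(d2_2 x) -!comp_assoc pb3_comm.
have nat_m := nt_natural (mon_mult T) (d0_1 x).
rewrite [RHS]comp_assoc -[fmap T (d0_1 x) ∘ _]nat_m /= -!comp_assoc; congr (_ ∘ _).
by rewrite !comp_assoc -!fmap_comp pb2_comm.
Qed.

Definition d2_3 : ob3 x ~> ob2 x := pb_lift (pb2 x) d2_3_subproof.

End Structure.

Record Multicategory := {
  premc :> PreMulticategory;
  mc_unitl : d1_2 premc ∘ s0_1 premc = id (ob1 premc);
  mc_unitr : d1_2 premc ∘ s1_1 premc = id (ob1 premc);
  mc_assoc : d1_2 premc ∘ d1_3 premc = d1_2 premc ∘ d2_3 premc
}.

(* A pair (p_0, p_1) compatible with d_0 and d_1 on x_1, which is what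
   is needed to define p_2 and p_3. *)
Record MCGraphHom (x y : PreMulticategory) := {
  map0 : ob0 x ~> ob0 y;
  map1 : ob1 x ~> ob1 y;
  map_d0_1 : d0_1 y ∘ map1 = map0 ∘ d0_1 x;
  map_d1_1 : d1_1 y ∘ map1 = fmap T map0 ∘ d1_1 x
}.

Section InducedMaps.
Variables (x y : PreMulticategory) (p : MCGraphHom x y).

Lemma map2_subproof :
  d1_1 y ∘ (map1 p ∘ d0_2 x) = fmap T (d0_1 y) ∘ (fmap T (map1 p) ∘ d2_2 x).
Proof.
rewrite !comp_assoc map_d1_1 -fmap_comp map_d0_1 fmap_comp -!comp_assoc.
by rewrite pb2_comm.
Qed.

Definition map2 : ob2 x ~> ob2 y := pb_lift (pb2 y) map2_subproof.

Lemma map_d0_2 : d0_2 y ∘ map2 = map1 p ∘ d0_2 x.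
Proof. exact: pb_fst_lift. Qed.

Lemma map_d2_2 : d2_2 y ∘ map2 = fmap T (map1 p) ∘ d2_2 x.
Proof. exact: pb_snd_lift. Qed.

Lemma map3_subproof :
  d2_2 y ∘ (map2 ∘ d0_3 x) = fmap T (d0_2 y) ∘ (fmap T map2 ∘ d3_3 x).
Proof.
rewrite !comp_assoc map_d2_2 -fmap_comp map_d0_2 fmap_comp -!comp_assoc.
by rewrite pb3_comm.
Qed.

Definition map3 : ob3 x ~> ob3 y := pb_lift (pb3 y) map3_subproof.

End InducedMaps.

Record MCFunctor (x y : Multicategory) := {
  mcf_graph :> MCGraphHom x y;
  map_s0_0 : map1 mcf_graph ∘ s0_0 x = s0_0 y ∘ map0 mcf_graph;
  map_d1_2 : map1 mcf_graph ∘ d1_2 x = d1_2 y ∘ map2 mcf_graph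
}.

Lemma mcf_eq (x y : Multicategory) (p q : MCFunctor x y) :
  map0 p = map0 q -> map1 p = map1 q -> p = q.
Proof.
case: p q => [[p0 p1 a b] c d] [[q0 q1 a' b'] c' d'] /= e0 e1.
case: _ / e0 a' b' c' d' => a' b'; case: _ / e1 a' b' => a' b'.
have <- := proof_irrelevance _ a a'; have <- := proof_irrelevance _ b b'.
by move=> c' d'; rewrite (proof_irrelevance _ c c') (proof_irrelevance _ d d').
Qed.

Program Definition mcf_id (x : Multicategory) : MCFunctor x x :=
  {| mcf_graph := {| map0 := id (ob0 x); map1 := id (ob1 x) |} |}.
Next Obligation. by move=> x; rewrite comp_idl comp_idr. Qed.
Next Obligation. by move=> x; rewrite fmap_id comp_idl comp_idr. Qed.
Next Obligation. by move=> x; rewrite /= comp_idl comp_idr. Qed.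
Next Obligation.
move=> x /=; rewrite comp_idl -[LHS]comp_idr; congr (_ ∘ _).
apply: (@pb_ext _ _ _ _ _ _ (pb2 x)).
  by rewrite pb_fst_lift /= comp_idl comp_idr.
by rewrite pb_snd_lift /= fmap_id comp_idl comp_idr.
Qed.

Program Definition mcf_comp (x y z : Multicategory) (q : MCFunctor y z)
    (p : MCFunctor x y) : MCFunctor x z :=
  {| mcf_graph := {| map0 := map0 q ∘ map0 p; map1 := map1 q ∘ map1 p |} |}.
Next Obligation.
by move=> x y z q p; rewrite comp_assoc map_d0_1 -!comp_assoc map_d0_1.
Qed.
Next Obligation.
by move=> x y z q p; rewrite comp_assoc map_d1_1 -!comp_assoc map_d1_1 fmap_comp !comp_assoc.
Qed.
Next Obligation.
by move=> x y z q p; rewrite /= -comp_assoc map_s0_0 !comp_assoc map_s0_0.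
Qed.
Next Obligation.
move=> x y z q p /=; rewrite -comp_assoc map_d1_2 comp_assoc map_d1_2 -comp_assoc.
congr (_ ∘ _); apply: (@pb_ext _ _ _ _ _ _ (pb2 z)).
  rewrite pb_fst_lift comp_assoc pb_fst_lift /= -!comp_assoc.
  by congr (_ ∘ _); apply: map_d0_2.
rewrite pb_snd_lift comp_assoc pb_snd_lift /= fmap_comp -!comp_assoc.
by congr (_ ∘ _); apply: map_d2_2.
Qed.

Program Definition CatT : Category :=
  {| obj := Multicategory; hom := MCFunctor; id := mcf_id; comp := mcf_comp |}.
Next Obligation. by move=> *; apply: mcf_eq; apply: comp_idl. Qed.
Next Obligation. by move=> *; apply: mcf_eq; apply: comp_idr. Qed.
Next Obligation. by move=> *; apply: mcf_eq; apply: comp_assoc. Qed.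

End Multicategories.

(* Main.v *)
(* The unit of T being cartesian, p_1 and p_2 are pullbacks of T p_1 and T p_2,
   so p_1 is effective for descent, every pullback of p_2 is a strict
   epimorphism and every pullback of p_3 is an epimorphism.  Pullbacks of
   T-multicategories are computed levelwise, so a descent datum (a, xi) for p
   gives one for p_1, hence a quotient h_1 : a_1 -> b_1.  The idempotent
   s_0 d_0 of a_1 passes to b_1, and splitting it yields b_0 together with d_0
   and s_0: nothing has to be known about p_0.  The map d_1 : b_1 -> T b_0 is
   induced along h_1 and the composition b_2 -> b_1 along h_2, because h_1 and
   h_2 are pullbacks of p_1 and p_2; the multicategory axioms are checked after
   the epimorphisms h_1, h_2 and h_3, the last one being a pullback of p_3. *)

From Stdlib Require Import ProofIrrelevance IndefiniteDescription FinFun List.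
From mathcomp Require Import ssreflect ssrfun ssrbool.
Require Import Defs.
Local Open Scope cat_scope.

Set Implicit Arguments.
Unset Strict Implicit.
Unset Printing Implicit Defensive.
#[local] Obligation Tactic := idtac.

(** * Finite limits *)

(** The monadic definition speaks of chosen pullbacks and of algebras in slices, which are awkward
    to restrict to one level of a multicategory. Both are replaced by [effective], a condition on
    arbitrary pullback squares and generalized elements: the hypotheses in [B] are translated into
    it, and the conclusion is translated back in [CatT T]. The first translation uses products in
    [B], because the comparison functor sees only maps over the base. The three strengths of
    hypothesis match three tasks: level 1 has to produce an object, level 2 a morphism out of b_2,
    level 3 an equation between morphisms out of b_3. Level 0 follows level 1, since x_0 is a
    retract of x_1, naturally in x, so that maps, epimorphisms and pullback squares at level 0 are
    inherited by retraction. *)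

Program Definition thin_category (I : Type) (le : I -> I -> bool)
    (le_refl : forall i, le i i) (le_trans : forall i j k, le i j -> le j k -> le i k) :
    Category :=
  {| obj := I; hom := fun i j => is_true (le i j); id := fun i => le_refl i;
     comp := fun i j k v u => le_trans i j k u v |}.
Next Obligation. by move=> *; apply: proof_irrelevance. Qed.
Next Obligation. by move=> *; apply: proof_irrelevance. Qed.
Next Obligation. by move=> *; apply: proof_irrelevance. Qed.

Lemma thin_category_finite (I : Type) (le : I -> I -> bool) rI tI :
  Finite I -> finite_category (@thin_category I le rI tI).
Proof.
move=> finI; split=> // i j; rewrite /= /is_true.
by case: (le i j); [exists (erefl :: nil) => e; left; apply: proof_irrelevance | exists nil].
Qed.

Definition same (i j : bool) : bool := ~~ (i (+) j).

Definition cospan_le (i j : option bool) : bool :=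
  match i, j with
  | _, None => true
  | Some i, Some j => same i j
  | None, Some _ => false
  end.

Lemma cospan_le_refl i : cospan_le i i.
Proof. by case: i => [[]|]. Qed.

Lemma cospan_le_trans i j k : cospan_le i j -> cospan_le j k -> cospan_le i k.
Proof. by case: i j k => [[]|] [[]|] [[]|]. Qed.

Definition cospan : Category := thin_category cospan_le_refl cospan_le_trans.

Lemma same_refl i : same i i.
Proof. by case: i. Qed.

Lemma same_trans i j k : same i j -> same j k -> same i k.
Proof. by case: i j k => [] [] []. Qed.

Definition discrete_pair : Category := thin_category same_refl same_trans.

Definition has_products (C : Category) : Prop :=
  forall a b : C, exists (q : C) (u : q ~> a) (v : q ~> b),
  forall w (s : w ~> a) (t : w ~> b), exists! h : w ~> q, u ∘ h = s /\ v ∘ h = t.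

Section LimitDiagrams.
Variables (C : Category) (a b c : C) (f : a ~> c) (g : b ~> c).

Definition cospan_obj (i : cospan) : C :=
  match i with Some true => a | Some false => b | None => c end.

Program Definition cospan_diagram : Functor cospan C :=
  {| fobj := cospan_obj;
     fmap := fun i j =>
       match i, j return cospan_le i j -> cospan_obj i ~> cospan_obj j with
       | Some true, Some true => fun _ => id a
       | Some true, Some false => fun h => False_rect _ (notF h)
       | Some true, None => fun _ => f
       | Some false, Some false => fun _ => id b
       | Some false, Some true => fun h => False_rect _ (notF h)
       | Some false, None => fun _ => g
       | None, Some true => fun h => False_rect _ (notF h)
       | None, Some false => fun h => False_rect _ (notF h)
       | None, None => fun _ => id c
       end |}.
Next Obligation. by case=> [[]|]. Qed.
Next Obligation.
by case=> [[]|] [[]|] [[]|] v u //=; rewrite ?comp_idl ?comp_idr.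
Qed.

Program Definition cospan_cone w (s : w ~> a) (t : w ~> b) (e : f ∘ s = g ∘ t) :
    Cone cospan_diagram :=
  {| apex := w;
     leg := fun i => match i return w ~> cospan_obj i with
       | Some true => s | Some false => t | None => f ∘ s end |}.
Next Obligation.
by move=> w s t e; case=> [[]|] [[]|] u //=; rewrite ?comp_idl // e.
Qed.

Definition pair_obj (i : discrete_pair) : C := if i then a else b.

Program Definition pair_diagram : Functor discrete_pair C :=
  {| fobj := pair_obj;
     fmap := fun i j =>
       match i, j return same i j -> pair_obj i ~> pair_obj j with
       | true, true => fun _ => id a
       | false, false => fun _ => id b
       | true, false => fun h => False_rect _ (notF h)
       | false, true => fun h => False_rect _ (notF h)
       end |}.
Next Obligation. by case. Qed.
Next Obligation. by case=> [] [] [] v u //=; rewrite comp_idl. Qed.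

Program Definition pair_cone w (s : w ~> a) (t : w ~> b) : Cone pair_diagram :=
  {| apex := w; leg := fun i => if i return w ~> pair_obj i then s else t |}.
Next Obligation. by move=> w s t [] [] u //=; rewrite comp_idl. Qed.

End LimitDiagrams.

(* The free category on an idempotent: the morphism [true] is the identity. *)
Program Definition idempotent_category : Category :=
  {| obj := unit; hom := fun _ _ => bool; id := fun _ => true;
     comp := fun _ _ _ u v => u && v |}.
Next Obligation. by []. Qed.
Next Obligation. by move=> *; apply: andbT. Qed.
Next Obligation. by move=> *; apply: andbA. Qed.

Section Idempotents.
Variables (C : Category) (a : C) (e : a ~> a) (ee : e ∘ e = e).

Program Definition idempotent_diagram : Functor idempotent_category C :=
  {| fobj := fun _ => a;
     fmap := fun _ _ u => match u with true => id a | false => e end |}.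
Next Obligation. by []. Qed.
Next Obligation. by move=> ? ? ? [] [] //=; rewrite ?ee ?comp_idl ?comp_idr. Qed.

Program Definition idempotent_cone : Cone idempotent_diagram :=
  {| apex := a; leg := fun _ => e |}.
Next Obligation. by move=> ? ? [] /=; rewrite ?ee ?comp_idl. Qed.

End Idempotents.

Section FiniteLimits.
Variables (C : Category) (hC : has_finite_limits C).

Lemma finite_limits_pullback (a b c : C) (f : a ~> c) (g : b ~> c) :
  exists P : Pullback f g, True.
Proof.
have fin : finite_category cospan.
  apply: thin_category_finite.
  exists (None :: Some true :: Some false :: nil).
  by case=> [[]|] /=; auto.
case: (hC fin (cospan_diagram f g)) => L limL.
unshelve eexists (@Build_Pullback _ _ _ _ _ _ (apex L) (leg L (Some true)) (leg L (Some false)) _) => //.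
have e1 := leg_natural L (erefl : hom (Some true : cospan) None).
have e2 := leg_natural L (erefl : hom (Some false : cospan) None).
rewrite /= in e1 e2; split; first by rewrite e1 e2.
move=> w s t e; case: (limL (cospan_cone e)) => h [hE hU].
exists h; split; first by split; [apply: (hE (Some true)) | apply: (hE (Some false))].
move=> h' [h1 h2]; apply: hU; case=> [[]|] //=.
by rewrite -e1 -comp_assoc; congr (_ ∘ _).
Qed.

Lemma finite_limits_products : has_products C.
Proof.
move=> a b.
have fin : finite_category discrete_pair.
  apply: thin_category_finite; exists (true :: false :: nil).
  by case=> /=; auto.
case: (hC fin (pair_diagram a b)) => L limL.
exists (apex L), (leg L true), (leg L false) => w s t.
case: (limL (pair_cone s t)) => h [hE hU].
exists h; split; first by split; [apply: (hE true) | apply: (hE false)].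
by move=> h' [h1 h2]; apply: hU; case.
Qed.

(** The limit of the diagram is the object of fixed points of [e]. Its leg is [i]; idempotency makes
    [e] itself a cone, and that cone induces [r]. *)
Lemma finite_limits_split (a : C) (e : a ~> a) :
  e ∘ e = e -> exists (b : C) (i : b ~> a) (r : a ~> b), r ∘ i = id b /\ i ∘ r = e.
Proof.
move=> ee.
have fin : finite_category idempotent_category.
  split; first by exists (tt :: nil); case; left.
  by move=> *; exists (true :: false :: nil); case=> /=; auto.
case: (hC fin (idempotent_diagram ee)) => L limL.
have eL : e ∘ leg L tt = leg L tt := leg_natural L (false : hom (tt : idempotent_category) tt).
case: (limL (idempotent_cone ee)) => r [/(_ tt) /= rE _].
exists (apex L), (leg L tt), r; split=> //.
case: (limL L) => h [_ hU].
rewrite -(hU (id _)) ?(hU (r ∘ leg L tt)) // => -[]; last by rewrite comp_idr.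
by rewrite comp_assoc rE.
Qed.

End FiniteLimits.

(** * Descent in terms of generalized elements *)

Section Pullbacks.
Variable C : Category.

(** Applies an equation in the middle of a right-associated chain, where [g ∘ f] is not a
    subterm. *)
Lemma compA_eq (a b c d : C) (g : b ~> c) (f : a ~> b) (r : a ~> c) :
  g ∘ f = r -> forall (k : d ~> a), g ∘ (f ∘ k) = r ∘ k.
Proof. by move=> <- k; rewrite comp_assoc. Qed.

Lemma pullback_joint (a b c q : C) (f : a ~> c) (g : b ~> c) (u : q ~> a) (v : q ~> b) :
  is_pullback f g u v ->
  forall w (h k : w ~> q), u ∘ h = u ∘ k -> v ∘ h = v ∘ k -> h = k.
Proof. by move=> pb w h k; apply: (pb_ext (P := Build_Pullback pb)). Qed.

Lemma pullback_fill (a b c q : C) (f : a ~> c) (g : b ~> c) (u : q ~> a) (v : q ~> b) :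
  is_pullback f g u v ->
  forall w (s : w ~> a) (t : w ~> b), f ∘ s = g ∘ t ->
  exists h : w ~> q, u ∘ h = s /\ v ∘ h = t.
Proof. by move=> [_ pb] w s t /pb [h [hE _]]; exists h. Qed.

Lemma is_pullback_intro (a b c q : C) (f : a ~> c) (g : b ~> c) (u : q ~> a) (v : q ~> b) :
  f ∘ u = g ∘ v ->
  (forall w (s : w ~> a) (t : w ~> b), f ∘ s = g ∘ t ->
     exists h : w ~> q, u ∘ h = s /\ v ∘ h = t) ->
  (forall w (h k : w ~> q), u ∘ h = u ∘ k -> v ∘ h = v ∘ k -> h = k) ->
  is_pullback f g u v.
Proof.
move=> e fill joint; split=> // w s t /fill [h [hu hv]].
by exists h; split=> // h' [hu' hv']; apply: joint; rewrite ?hu ?hv.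
Qed.

Lemma is_pullback_sym (a b c q : C) (f : a ~> c) (g : b ~> c) (u : q ~> a) (v : q ~> b) :
  is_pullback f g u v -> is_pullback g f v u.
Proof.
move=> pb; apply: is_pullback_intro.
- by rewrite pb.1.
- by move=> w s t /esym /(pullback_fill pb) [h [hu hv]]; exists h.
- by move=> w h k hv hu; apply: (pullback_joint pb).
Qed.

Lemma pullback_iso (a b c q q' : C) (f : a ~> c) (g : b ~> c) (u : q ~> a) (v : q ~> b)
    (u' : q' ~> a) (v' : q' ~> b) (i : q' ~> q) (j : q ~> q') :
  u ∘ i = u' -> v ∘ i = v' -> j ∘ i = id q' -> i ∘ j = id q ->
  is_pullback f g u v -> is_pullback f g u' v'.
Proof.
move=> <- <- ji ij pb; apply: is_pullback_intro.
- by rewrite !comp_assoc pb.1.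
- move=> w s t /(pullback_fill pb) [m [um vm]].
  by exists (j ∘ m); rewrite -!comp_assoc !(compA_eq ij) !comp_idl.
- move=> w r s; rewrite -!comp_assoc => e1 e2.
  rewrite -[r]comp_idl -[s]comp_idl -ji -!comp_assoc; congr (_ ∘ _).
  exact: (pullback_joint pb).
Qed.

(* Squares are oriented as in [is_pullback]: the pasted square is
   [a -h-> b -f-> b'] over [x -k-> y -g-> y']. *)
Lemma pullback_paste (a b b' x y y' : C) (h : a ~> b) (f : b ~> b')
    (q : a ~> x) (n : b ~> y) (n' : b' ~> y') (k : x ~> y) (g : y ~> y') :
  is_pullback n k h q -> is_pullback n' g f n -> is_pullback n' (g ∘ k) (f ∘ h) q.
Proof.
move=> pb1 pb2; apply: is_pullback_intro.
- by rewrite comp_assoc pb2.1 -!comp_assoc pb1.1.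
- move=> w s t; rewrite -comp_assoc => /(pullback_fill pb2) [r [fr nr]].
  case: (pullback_fill pb1 nr) => m [hm qm].
  by exists m; rewrite -comp_assoc hm.
- move=> w r s; rewrite -!comp_assoc => e1 e2.
  apply: (pullback_joint pb1) => //; apply: (pullback_joint pb2) => //.
  by rewrite !comp_assoc pb1.1 -!comp_assoc e2.
Qed.

Lemma pullback_cancel (a b b' x y y' : C) (h : a ~> b) (f : b ~> b')
    (q : a ~> x) (n : b ~> y) (n' : b' ~> y') (k : x ~> y) (g : y ~> y') :
  n ∘ h = k ∘ q -> is_pullback n' g f n -> is_pullback n' (g ∘ k) (f ∘ h) q ->
  is_pullback n k h q.
Proof.
move=> e pb2 pb3; apply: is_pullback_intro => //.
- move=> w s t nst.
  have := pullback_fill pb3 (s := f ∘ s) (t := t).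
  case; first by rewrite comp_assoc pb2.1 -!comp_assoc nst.
  move=> m [fm qm]; exists m; split=> //; apply: (pullback_joint pb2).
    by rewrite -fm comp_assoc.
  by rewrite comp_assoc e -comp_assoc qm nst.
- move=> w r s e1 e2; apply: (pullback_joint pb3) => //.
  by rewrite -!comp_assoc e1.
Qed.

(** Elements are pushed into the second square along the sections, filled there and brought back
    along [ra]. With s_0 as section and d_0 as retraction, a pullback of arrows yields one of
    objects. *)
Lemma pullback_retract (a0 b0 x0 y0 a1 b1 x1 y1 : C)
    (h0 : a0 ~> b0) (q0 : a0 ~> x0) (n0 : b0 ~> y0) (p0 : x0 ~> y0)
    (h1 : a1 ~> b1) (q1 : a1 ~> x1) (n1 : b1 ~> y1) (p1 : x1 ~> y1)
    (ia : a0 ~> a1) (ib : b0 ~> b1) (ix : x0 ~> x1) (iy : y0 ~> y1)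
    (ra : a1 ~> a0) (rb : b1 ~> b0) (rx : x1 ~> x0) :
  ra ∘ ia = id a0 -> rb ∘ ib = id b0 -> rx ∘ ix = id x0 ->
  h1 ∘ ia = ib ∘ h0 -> q1 ∘ ia = ix ∘ q0 ->
  n1 ∘ ib = iy ∘ n0 -> p1 ∘ ix = iy ∘ p0 ->
  h0 ∘ ra = rb ∘ h1 -> q0 ∘ ra = rx ∘ q1 -> n0 ∘ h0 = p0 ∘ q0 ->
  is_pullback n1 p1 h1 q1 -> is_pullback n0 p0 h0 q0.
Proof.
move=> Ea Eb Ex ih iq in_ ip rh rq e pb; apply: is_pullback_intro => //.
- move=> w s t nst.
  have := pullback_fill pb (s := ib ∘ s) (t := ix ∘ t).
  case; first by rewrite !comp_assoc in_ ip -!comp_assoc nst.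
  move=> m [hm qm]; exists (ra ∘ m); split.
    by rewrite comp_assoc rh -comp_assoc hm comp_assoc Eb comp_idl.
  by rewrite comp_assoc rq -comp_assoc qm comp_assoc Ex comp_idl.
- move=> w r s e1 e2.
  rewrite -[r]comp_idl -[s]comp_idl -Ea -!comp_assoc; congr (_ ∘ _).
  apply: (pullback_joint pb); rewrite !comp_assoc.
    by rewrite ih -!comp_assoc e1.
  by rewrite iq -!comp_assoc e2.
Qed.

(* Limits commute with limits: the pullbacks [d -> a, b] of four cospans
   [a -> c <- b], indexed by the corners of a square, again form a pullback
   square when the squares formed by the [a]'s, the [b]'s and the [c]'s do. *)
Lemma pullback_of_pullbacks
    (a1 b1 c1 d1 a2 b2 c2 d2 a3 b3 c3 d3 a4 b4 c4 d4 : C)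
    (f1 : a1 ~> c1) (g1 : b1 ~> c1) (u1 : d1 ~> a1) (v1 : d1 ~> b1)
    (f2 : a2 ~> c2) (g2 : b2 ~> c2) (u2 : d2 ~> a2) (v2 : d2 ~> b2)
    (f3 : a3 ~> c3) (g3 : b3 ~> c3) (u3 : d3 ~> a3) (v3 : d3 ~> b3)
    (f4 : a4 ~> c4) (g4 : b4 ~> c4) (u4 : d4 ~> a4) (v4 : d4 ~> b4)
    (ha : a1 ~> a2) (qa : a1 ~> a3) (na : a2 ~> a4) (pa : a3 ~> a4)
    (hb : b1 ~> b2) (qb : b1 ~> b3) (nb : b2 ~> b4) (pb : b3 ~> b4)
    (hc : c1 ~> c2) (qc : c1 ~> c3) (nc : c2 ~> c4) (pc : c3 ~> c4)
    (hd : d1 ~> d2) (qd : d1 ~> d3) (nd : d2 ~> d4) (pd : d3 ~> d4) :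
  is_pullback f1 g1 u1 v1 -> is_pullback f2 g2 u2 v2 ->
  is_pullback f3 g3 u3 v3 -> is_pullback f4 g4 u4 v4 ->
  is_pullback na pa ha qa -> is_pullback nb pb hb qb -> is_pullback nc pc hc qc ->
  hc ∘ f1 = f2 ∘ ha -> hc ∘ g1 = g2 ∘ hb -> qc ∘ f1 = f3 ∘ qa -> qc ∘ g1 = g3 ∘ qb ->
  u2 ∘ hd = ha ∘ u1 -> v2 ∘ hd = hb ∘ v1 -> u3 ∘ qd = qa ∘ u1 -> v3 ∘ qd = qb ∘ v1 ->
  u4 ∘ nd = na ∘ u2 -> v4 ∘ nd = nb ∘ v2 -> u4 ∘ pd = pa ∘ u3 -> v4 ∘ pd = pb ∘ v3 ->
  is_pullback nd pd hd qd.
Proof.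
move=> P1 P2 P3 P4 Pa Pb Pc hf hg qf qg uh vh uq vq un vn up vp.
apply: is_pullback_intro.
- apply: (pullback_joint P4); rewrite !comp_assoc ?un ?vn ?up ?vp -!comp_assoc
    ?uh ?vh ?uq ?vq !comp_assoc.
    by rewrite Pa.1.
  by rewrite Pb.1.
- move=> w s t nst.
  have := pullback_fill Pa (s := u2 ∘ s) (t := u3 ∘ t).
  case; first by rewrite !comp_assoc -un -up -!comp_assoc nst.
  move=> ma [hma qma].
  have := pullback_fill Pb (s := v2 ∘ s) (t := v3 ∘ t).
  case; first by rewrite !comp_assoc -vn -vp -!comp_assoc nst.
  move=> mb [hmb qmb].
  case: (pullback_fill P1 (s := ma) (t := mb)).
    apply: (pullback_joint Pc); rewrite !comp_assoc ?hf ?hg ?qf ?qg -!comp_assoc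
      ?hma ?hmb ?qma ?qmb !comp_assoc.
      by rewrite P2.1.
    by rewrite P3.1.
  move=> m [um vm]; exists m; split.
    apply: (pullback_joint P2); rewrite !comp_assoc ?uh ?vh -!comp_assoc.
      by rewrite um.
    by rewrite vm.
  apply: (pullback_joint P3); rewrite !comp_assoc ?uq ?vq -!comp_assoc.
    by rewrite um.
  by rewrite vm.
- move=> w r s e1 e2; apply: (pullback_joint P1).
    apply: (pullback_joint Pa); rewrite !comp_assoc -?uh -?uq -!comp_assoc.
      by rewrite e1.
    by rewrite e2.
  apply: (pullback_joint Pb); rewrite !comp_assoc -?vh -?vq -!comp_assoc.
    by rewrite e1.
  by rewrite e2.
Qed.

(** * Strict epimorphisms and descent data *)

Definition epi (a b : C) (f : a ~> b) : Prop :=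
  forall c (g g' : b ~> c), g ∘ f = g' ∘ f -> g = g'.

(** A joint coequalizer of all the pairs that [f] identifies; where the kernel pair exists, this is
    a regular epimorphism. *)
Definition strict_epi (a b : C) (f : a ~> b) : Prop :=
  epi f /\
  forall c (k : a ~> c), (forall w (r s : w ~> a), f ∘ r = f ∘ s -> k ∘ r = k ∘ s) ->
  exists g : b ~> c, g ∘ f = k.

Definition universally (Q : forall a b : C, (a ~> b) -> Prop) (x y : C) (p : x ~> y) : Prop :=
  forall a b (n : b ~> y) (h : a ~> b) (q : a ~> x), is_pullback n p h q -> Q a b h.

Lemma strict_epi_split (a b c : C) (h : a ~> b) (i : c ~> a) (j : a ~> c) :
  i ∘ j = id a -> strict_epi (h ∘ i) -> strict_epi h.
Proof.
move=> ij [hiE hiS]; split=> [d g g' e|d k kh].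
  by apply: hiE; rewrite !comp_assoc e.
have [w r s|g gE] := hiS d (k ∘ i).
  by rewrite -!comp_assoc; apply: kh.
by exists g; rewrite -[LHS]comp_idr -[RHS]comp_idr -ij !comp_assoc -gE !comp_assoc.
Qed.

Lemma universally_pullback (Q : forall a b : C, (a ~> b) -> Prop) (x y x' y' : C)
    (p : x ~> y) (p' : x' ~> y') (f : y' ~> y) (f' : x' ~> x) :
  is_pullback f p p' f' -> universally Q p -> universally Q p'.
Proof.
move=> pb Qp a b n h q pb'; apply: (Qp _ _ (f ∘ n) _ (f' ∘ q)).
by apply/is_pullback_sym/(pullback_paste (is_pullback_sym pb') (is_pullback_sym pb)).
Qed.

(** An algebra for the descent monad of [p], on an arbitrary pullback [P]. If an element of [P] is
    written (a, c) after its images under [u] and [v], the last two fields read xi(a, q a) = a and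
    xi(xi(a, c), c') = xi(a, c'). *)
Record descent_datum (x y : C) (p : x ~> y) (a P : C) (q : a ~> x)
    (u : P ~> a) (v : P ~> x) (xi : P ~> a) : Prop := {
  dd_pullback : is_pullback (p ∘ q) p u v;
  dd_over : q ∘ xi = v;
  dd_unit : forall w (r : w ~> P), v ∘ r = q ∘ u ∘ r -> xi ∘ r = u ∘ r;
  dd_mult : forall w (s t t' : w ~> P),
    u ∘ t = xi ∘ s -> u ∘ t' = u ∘ s -> v ∘ t' = v ∘ t -> xi ∘ t = xi ∘ t'
}.

(** The first clause accounts for full faithfulness of the comparison functor, the second for
    essential surjectivity: [h ∘ xi = h ∘ u] forces [xi] to be the canonical action on the pullback
    of [n]. *)
Definition effective (x y : C) (p : x ~> y) : Prop :=
  universally strict_epi p /\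
  forall a P (q : a ~> x) (u : P ~> a) (v : P ~> x) (xi : P ~> a),
    descent_datum p q u v xi ->
    exists (b : C) (n : b ~> y) (h : a ~> b), is_pullback n p h q /\ h ∘ xi = h ∘ u.

(* The action of a descent datum generates the kernel pair of its quotient. *)
Lemma kernel_pair_action (x y a b P : C) (p : x ~> y) (n : b ~> y) (h : a ~> b)
    (q : a ~> x) (u : P ~> a) (v : P ~> x) (xi : P ~> a) :
  is_pullback n p h q -> is_pullback (p ∘ q) p u v -> q ∘ xi = v -> h ∘ xi = h ∘ u ->
  forall w (r s : w ~> a), h ∘ r = h ∘ s -> exists t : w ~> P, u ∘ t = r /\ xi ∘ t = s.
Proof.
move=> pb pbP qxi hxi w r s e.
case: (pullback_fill pbP (s := r) (t := q ∘ s)).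
  by rewrite comp_assoc -pb.1 -!comp_assoc e !comp_assoc pb.1.
move=> t [ut vt]; exists t; split=> //; apply: (pullback_joint pb).
  by rewrite comp_assoc hxi -comp_assoc ut.
by rewrite comp_assoc qxi.
Qed.

(** All pairs identified by [h] come from [u] and [xi], so one equation suffices to descend [k]. The
    idempotent, d_1 and the composition of the quotient multicategory arise this way. *)
Lemma effective_factor (x y a b P c : C) (p : x ~> y) (n : b ~> y) (h : a ~> b)
    (q : a ~> x) (u : P ~> a) (v : P ~> x) (xi : P ~> a) (k : a ~> c) :
  strict_epi h ->
  is_pullback n p h q -> is_pullback (p ∘ q) p u v -> q ∘ xi = v -> h ∘ xi = h ∘ u ->
  k ∘ xi = k ∘ u -> exists g : b ~> c, g ∘ h = k.
Proof.
move=> [_ hS] pb pbP qxi hxi kxi; apply: hS => w r s.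
case/(kernel_pair_action pb pbP qxi hxi) => t [<- <-].
by rewrite !comp_assoc kxi.
Qed.

(** By pasting, the pullback of [p' ∘ q] along [p'] is also one for [p], so a datum for [p'] becomes
    a datum for [p] after composing with [f']. Its quotient lies over [y'] because [p' ∘ q] factors
    through [h], and cancellation gives the square over [p']. *)
Lemma effective_pullback (x y x' y' : C)
    (p : x ~> y) (p' : x' ~> y') (f : y' ~> y) (f' : x' ~> x) :
  is_pullback f p p' f' -> effective p -> effective p'.
Proof.
move=> pb [pS pE]; have pS' := universally_pullback pb pS; split=> //.
move=> a P q u v xi [pbP qxi unitP multP].
have pbP' : is_pullback (p ∘ (f' ∘ q)) p u (f' ∘ v).
  rewrite comp_assoc -pb.1 -comp_assoc.
  apply: is_pullback_sym; apply: (pullback_paste (is_pullback_sym pbP)).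
  exact: is_pullback_sym.
have joint w (r s : w ~> x') : f' ∘ r = f' ∘ s -> p' ∘ r = p' ∘ s -> r = s.
  by move=> e1 e2; apply: (pullback_joint pb).
have [|b [n [h [pbh hxi]]]] := pE a P (f' ∘ q) u (f' ∘ v) xi.
  split=> //.
  - by rewrite -comp_assoc qxi.
  - move=> w r e; apply: unitP; apply: joint; first by rewrite !comp_assoc.
    by rewrite !comp_assoc -pbP.1.
  - move=> w s t t' e1 e2 e3; apply: (multP w s t t') => //; apply: joint.
      by rewrite !comp_assoc.
    rewrite !comp_assoc -pbP.1 -!comp_assoc e1 e2 (compA_eq qxi).
    by rewrite !comp_assoc pbP.1.
have hS := pS _ _ _ _ _ pbh.
have [n' n'h] : exists n' : b ~> y', n' ∘ h = p' ∘ q.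
  apply: (effective_factor hS pbh pbP' _ hxi); first by rewrite -comp_assoc qxi.
  by rewrite -comp_assoc qxi -pbP.1.
have fn' : f ∘ n' = n.
  by apply: hS.1; rewrite -comp_assoc n'h pbh.1 !comp_assoc pb.1.
exists b, n', h; split=> //.
apply/is_pullback_sym.
apply: (pullback_cancel _ (is_pullback_sym pb)); first by rewrite n'h.
by rewrite fn'; apply: is_pullback_sym.
Qed.

End Pullbacks.

(** * Equivalences of categories and the comparison functor *)

Lemma equivalence_faithful (C D : Category) (F : Functor C D) (G : Functor D C) :
  naturally_isomorphic (FComp G F) (FId C) -> faithful F.
Proof.
move=> [t tI] a b f g e; have [s [st ts]] := tI a.
have eG : fmap (FComp G F) f = fmap (FComp G F) g by rewrite /= e.
rewrite -[f]comp_idr -[g]comp_idr -ts !comp_assoc; congr (_ ∘ _).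
by have /= <- := nt_natural t f; have /= <- := nt_natural t g; rewrite e.
Qed.

Lemma equivalence_full (C D : Category) (F : Functor C D) :
  is_equivalence F -> full F.
Proof.
move=> [G [GF FG]] a b k.
(* [G] is faithful too, so the candidate preimage can be checked after applying [G]. *)
have Gf := equivalence_faithful FG.
have [t tI] := GF; have [s [st ts]] := tI a; have [s' [st' ts']] := tI b.
exists (t b ∘ fmap G k ∘ s); apply: Gf.
have /= nat_t := nt_natural t (t b ∘ fmap G k ∘ s).
rewrite -[LHS]comp_idl -st' -[s' ∘ t b ∘ _]comp_assoc nat_t.
by rewrite -!comp_assoc st comp_idr comp_assoc st' comp_idl.
Qed.

Lemma equivalence_essentially_surjective (C D : Category) (F : Functor C D) :
  is_equivalence F ->
  forall d : D, exists (c : C) (i : F c ~> d) (j : d ~> F c), i ∘ j = id d /\ j ∘ i = id (F c).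
Proof.
move=> [G [_ [t tI]]] d; have [s [st ts]] := tI d.
by exists (G d), (t d), s.
Qed.

Lemma ff_equivalence (C D : Category) (F : Functor C D) :
  fully_faithful F ->
  (forall d : D, exists (c : C) (i : F c ~> d) (j : d ~> F c),
     i ∘ j = id d /\ j ∘ i = id (F c)) ->
  is_equivalence F.
Proof.
move=> [Ffull Ffaith] es.
(* Indefinite description returns a single witness, so the object and its isomorphism are packed
   together. *)
have {}es (d : D) : exists s : {c : C & (F c ~> d) * (d ~> F c)}%type,
    (projT2 s).1 ∘ (projT2 s).2 = id d /\ (projT2 s).2 ∘ (projT2 s).1 = id (F (projT1 s)).
  by have [c [i [j e]]] := es d; exists (existT _ c (i, j)).
pose sel d := constructive_indefinite_description _ (es d).
pose G0 d := projT1 (proj1_sig (sel d)).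
pose i d : F (G0 d) ~> d := (projT2 (proj1_sig (sel d))).1.
pose j d : d ~> F (G0 d) := (projT2 (proj1_sig (sel d))).2.
have ij d : i d ∘ j d = id d := (proj2_sig (sel d)).1.
have ji d : j d ∘ i d = id (F (G0 d)) := (proj2_sig (sel d)).2.
pose pre a b (k : F a ~> F b) := constructive_indefinite_description _ (Ffull a b k).
pose G1 a b (f : a ~> b) : G0 a ~> G0 b := proj1_sig (pre _ _ (j b ∘ f ∘ i a)).
have G1E a b (f : a ~> b) : fmap F (G1 a b f) = j b ∘ f ∘ i a := proj2_sig (pre _ _ _).
have Gid a : G1 a a (id a) = id (G0 a).
  by apply: Ffaith; rewrite G1E comp_idr ji fmap_id.
have Gcomp a b c (g : b ~> c) (f : a ~> b) : G1 a c (g ∘ f) = G1 b c g ∘ G1 a b f.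
  apply: Ffaith; rewrite fmap_comp !G1E -!comp_assoc.
  by rewrite (compA_eq (ij b)) comp_idl.
pose G := {| fobj := G0; fmap := G1; fmap_id := Gid; fmap_comp := Gcomp |}.
exists G; split.
- pose t a : G0 (F a) ~> a := proj1_sig (pre _ _ (i (F a))).
  have tE a : fmap F (t a) = i (F a) := proj2_sig (pre _ _ _).
  have tN a b (f : a ~> b) : t b ∘ fmap (FComp G F) f = fmap (FId C) f ∘ t a.
    apply: Ffaith; rewrite !fmap_comp !tE /= G1E.
    by rewrite !comp_assoc ij comp_idl.
  exists {| nt := t : forall a, FComp G F a ~> FId C a; nt_natural := tN |} => a /=.
  have [s sE] := Ffull _ _ (j (F a)); exists s.
  by split; apply: Ffaith; rewrite fmap_comp sE tE ?ij ?ji fmap_id.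
- have tN a b (f : a ~> b) : i b ∘ fmap (FComp F G) f = fmap (FId D) f ∘ i a.
    by rewrite /= G1E !comp_assoc ij comp_idl.
  exists {| nt := i : forall a, FComp F G a ~> FId D a; nt_natural := tN |} => a /=.
  by exists (j a).
Qed.

(** * Descent data against algebras, and the comparison functor of an effective morphism *)

Section Comparison.
Variables (C : Category) (x y : C) (p : x ~> y) (P : pullbacks_along p).

Let T : Monad (Slice x) := adj_monad (base_change_adjunction P).
Let K : Functor (Slice y) (Desc P) := descent_comparison P.

Lemma comparison_fst (b c : Slice y) (f : b ~> c) :
  pb_fst (P (sl_map c)) ∘ sl_hom (alg_hom (fmap K f)) = sl_hom f ∘ pb_fst (P (sl_map b)).
Proof. exact: pb_fst_lift. Qed.

Lemma comparison_snd (b c : Slice y) (f : b ~> c) :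
  pb_snd (P (sl_map c)) ∘ sl_hom (alg_hom (fmap K f)) = pb_snd (P (sl_map b)).
Proof. exact: pb_snd_lift. Qed.

Lemma desc_hom_eq (A A' : Desc P) (f g : A ~> A') :
  f = g -> sl_hom (alg_hom f) = sl_hom (alg_hom g).
Proof. by move=> ->. Qed.

Lemma comparison_act_fst (b : Slice y) :
  pb_fst (P (sl_map b)) ∘ sl_hom (act (K b)) = pb_fst (P (sl_map b)) ∘ pb_fst (P _).
Proof. exact: pb_fst_lift. Qed.

Lemma comparison_act_snd (b : Slice y) :
  pb_snd (P (sl_map b)) ∘ sl_hom (act (K b)) = pb_snd (P _).
Proof. exact: pb_snd_lift. Qed.

Lemma algebra_hom_act (A A' : Desc P) (f : A ~> A') :
  let Tf := sl_hom (fmap T (alg_hom f)) in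
  [/\ sl_hom (alg_hom f) ∘ sl_hom (act A) = sl_hom (act A') ∘ Tf,
      pb_fst (P _) ∘ Tf = sl_hom (alg_hom f) ∘ pb_fst (P _)
    & pb_snd (P _) ∘ Tf = pb_snd (P _)].
Proof.
split; first exact: (f_equal (@sl_hom _ _ _ _) (alg_hom_act f)).
  exact: pb_fst_lift.
exact: pb_snd_lift.
Qed.

Lemma algebra_descent_datum (A : Desc P) :
  descent_datum p (sl_map (carrier A)) (pb_fst (P (p ∘ sl_map (carrier A)))) (pb_snd (P _))
    (sl_hom (act A)).
Proof.
have over : sl_map (carrier A) ∘ sl_hom (act A) = pb_snd (P _) := sl_hom_map (act A).
split=> //; first exact: pb_is_pullback.
- move=> w r e.
  pose eta' : carrier A ~> T (carrier A) := mon_unit T (carrier A); pose eta := sl_hom eta'.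
  have unitA : sl_hom (act A) ∘ eta = id _ := f_equal (@sl_hom _ _ _ _) (act_unit A).
  have e1 : pb_fst (P _) ∘ eta = id _ := pb_fst_lift _ _.
  have e2 : pb_snd (P _) ∘ eta = sl_map (carrier A) := pb_snd_lift _ _.
  (* An element of the form (a, q a) factors through the unit of the monad. *)
  have -> : r = eta ∘ (pb_fst (P _) ∘ r).
    apply: pb_ext; first by rewrite (compA_eq e1) comp_idl.
    by rewrite (compA_eq e2) e comp_assoc.
  by rewrite (compA_eq unitA) comp_idl (compA_eq e1) comp_idl.
- move=> w s t t' e1 e2 e3.
  pose mu' : T (T (carrier A)) ~> T (carrier A) := mon_mult T (carrier A).
  pose mu := sl_hom mu'; pose xi' := sl_hom (fmap T (act A)).
  have multA : sl_hom (act A) ∘ mu = sl_hom (act A) ∘ xi' :=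
    f_equal (@sl_hom _ _ _ _) (act_mult A).
  have m1 : pb_fst (P _) ∘ mu = pb_fst (P _) ∘ pb_fst (P _) := pb_fst_lift _ _.
  have m2 : pb_snd (P _) ∘ mu = pb_snd (P _) := pb_snd_lift _ _.
  have x1 : pb_fst (P _) ∘ xi' = sl_hom (act A) ∘ pb_fst (P _) := pb_fst_lift _ _.
  have x2 : pb_snd (P _) ∘ xi' = pb_snd (P _) := pb_snd_lift _ _.
  (* [s] and the [x]-component of [t] are the coordinates of an element [m] of the twofold pullback;
     the multiplication sends [m] to [t'], and the image of the action sends it to [t]. *)
  have st : (p ∘ pb_snd (P _)) ∘ s = p ∘ (pb_snd (P _) ∘ t).
    by rewrite -{1}over -!comp_assoc -e1 !comp_assoc pb_comm.
  have l1 := pb_fst_lift (P _) st; have l2 := pb_snd_lift (P _) st.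
  set m := pb_lift _ _ in l1 l2.
  have <- : xi' ∘ m = t.
    apply: (pb_ext (P := P (p ∘ sl_map (carrier A)))).
      by rewrite (compA_eq x1) -comp_assoc l1.
    by rewrite (compA_eq x2) l2.
  have <- : mu ∘ m = t'.
    apply: (pb_ext (P := P (p ∘ sl_map (carrier A)))).
      by rewrite (compA_eq m1) -comp_assoc l1.
    by rewrite (compA_eq m2) l2.
  by rewrite !comp_assoc multA.
Qed.

(** Every pullback of [p] is isomorphic to the chosen one, and the first premise transports the
    property along that isomorphism. *)
Lemma chosen_universally (Q : forall a b : C, (a ~> b) -> Prop) :
  (forall (a b c : C) (h : a ~> b) (i : c ~> a) (j : a ~> c),
     i ∘ j = id a -> Q c b (h ∘ i) -> Q a b h) ->
  (forall b : Slice y, Q _ _ (pb_fst (P (sl_map b)))) -> universally Q p.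
Proof.
move=> Qsplit QP a b n h q pb.
have [i [hi qi]] := pullback_fill pb (pb_comm (P n)).
have [j [hj qj]] := pullback_fill (pb_is_pullback (P n)) pb.1.
apply: (Qsplit _ _ _ _ i j); last by rewrite hi; apply: (QP (Build_SliceObj n)).
by apply: (pullback_joint pb); rewrite comp_assoc ?hi ?qi ?hj ?qj comp_idr.
Qed.

(** The action of [K b] generates the kernel pair of the projection to [b], and [f] commutes with
    the actions. *)
Lemma comparison_algebra_hom_kernel (b c : Slice y) (f : hom (K b) (K c)) :
  let k := pb_fst (P (sl_map c)) ∘ sl_hom (alg_hom f) in
  forall w (r s : w ~> P (sl_map b)),
    pb_fst (P (sl_map b)) ∘ r = pb_fst (P (sl_map b)) ∘ s -> k ∘ r = k ∘ s.
Proof.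
move=> k w r s e; have [f1 f2 f3] := algebra_hom_act f.
have [|t [<- <-]] := kernel_pair_action (pb_is_pullback (P (sl_map b)))
  (pb_is_pullback (P (p ∘ pb_snd (P (sl_map b))))) _ (comparison_act_fst b) e.
  exact: comparison_act_snd.
rewrite /k -!comp_assoc (compA_eq f1) -[in RHS]comp_assoc.
by rewrite (compA_eq (comparison_act_fst c)) -[RHS]comp_assoc (compA_eq f2) -!comp_assoc.
Qed.

Lemma effective_comparison : effective p -> is_equivalence K.
Proof.
move=> [pS pE]; apply: ff_equivalence; first split.
- move=> b c f; have [f1 f2 f3] := algebra_hom_act f.
  have hS := pS _ _ _ _ _ (pb_is_pullback (P (sl_map b))).
  have [g gE] := hS.2 _ _ (comparison_algebra_hom_kernel f).
  have gm : sl_map c ∘ g = sl_map b.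
    apply: hS.1; rewrite -comp_assoc gE comp_assoc pb_comm -comp_assoc.
    by rewrite (sl_hom_map (alg_hom f)) pb_comm.
  exists (Build_SliceHom gm); apply/alg_hom_eq/sl_hom_eq/pb_ext.
    by rewrite comparison_fst gE.
  by rewrite (sl_hom_map (alg_hom f)) (sl_hom_map (alg_hom (fmap K _))).
- move=> b c f g e; apply: sl_hom_eq.
  apply: (pS _ _ _ _ _ (pb_is_pullback (P (sl_map b)))).1.
  by rewrite -!comparison_fst e.
- move=> A; have [b [n [h [pb hxi]]]] := pE _ _ _ _ _ _ (algebra_descent_datum A).
  pose B' : Slice y := Build_SliceObj n.
  have [i [hi qi]] := pullback_fill pb (pb_comm (P n)).
  have [j [hj qj]] := pullback_fill (pb_is_pullback (P n)) pb.1.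
  have ij : i ∘ j = id _.
    by apply: (pullback_joint pb); rewrite comp_assoc ?hi ?qi ?hj ?qj comp_idr.
  have ji : j ∘ i = id _.
    by apply: pb_ext; rewrite comp_assoc ?hj ?qj ?hi ?qi comp_idr.
  pose i' : carrier (K B') ~> carrier A := @Build_SliceHom C x (carrier (K B')) (carrier A) i qi.
  pose j' : carrier A ~> carrier (K B') := @Build_SliceHom C x (carrier A) (carrier (K B')) j qj.
  (* Both sides land in the chosen pullback of [n]: their components in [b] agree by [hxi], those in
     [x] because the action of [A] is a map over [x]. *)
  have jA : j' ∘ act A = act (K B') ∘ fmap T j'.
    have t1 : pb_fst (P _) ∘ sl_hom (fmap T j') = j ∘ pb_fst (P _) := pb_fst_lift _ _.
    have t2 : pb_snd (P _) ∘ sl_hom (fmap T j') = pb_snd (P _) := pb_snd_lift _ _.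
    apply/sl_hom_eq/pb_ext.
      have /= e := comparison_act_fst B'.
      by rewrite /= (compA_eq hj) hxi (compA_eq e) -comp_assoc t1 (compA_eq hj).
    have /= e := comparison_act_snd B'.
    by rewrite /= (compA_eq qj) (compA_eq e) t2 (sl_hom_map (act A)).
  have ij' : i' ∘ j' = id _ by apply: sl_hom_eq.
  have ji' : j' ∘ i' = id _ by apply: sl_hom_eq.
  have iA : i' ∘ act (K B') = act A ∘ fmap T i'.
    rewrite -[LHS]comp_idr -(fmap_id T) -ji' fmap_comp -!comp_assoc.
    by rewrite (compA_eq (esym jA)) !comp_assoc ij' comp_idl.
  exists B', (@Build_AlgebraHom _ T (K B') A i' iA), (@Build_AlgebraHom _ T A (K B') j' jA).
  by split; apply: alg_hom_eq.
Qed.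

End Comparison.

(** * From the comparison functor back to epimorphisms *)

Section FullyFaithfulComparison.
Variables (C : Category) (x y : C) (p : x ~> y) (P : pullbacks_along p).

Hypothesis products : has_products C.

(** Faithfulness separates only maps over [y]. Pairing with [sl_map b] turns maps from [b] to an
    arbitrary [c] into maps over [y] to the product of [c] and [y]. *)
Lemma faithful_comparison_epi :
  faithful (descent_comparison P) -> forall b : Slice y, epi (pb_fst (P (sl_map b))).
Proof.
move=> pF b c g g' e; have [q [u [v uv]]] := products c y.
have [k [[uk vk] _]] := uv _ g (sl_map b); have [k' [[uk' vk'] _]] := uv _ g' (sl_map b).
pose c' : Slice y := Build_SliceObj v.
pose f : b ~> c' := @Build_SliceHom C y b c' k vk.
pose f' : b ~> c' := @Build_SliceHom C y b c' k' vk'.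
suff ff' : f = f' by rewrite -uk -uk'; have -> : k = k' := f_equal (@sl_hom _ _ _ _) ff'.
apply: pF; apply/alg_hom_eq/sl_hom_eq; apply: (pb_ext (P := P v)).
  rewrite (comparison_fst P f) (comparison_fst P f') /=.
  have [h [_ hU]] := uv _ (g ∘ pb_fst (P (sl_map b))) (sl_map b ∘ pb_fst (P (sl_map b))).
  have <- := hU (k ∘ pb_fst (P (sl_map b))); last by rewrite !comp_assoc uk vk.
  by apply: hU; rewrite !comp_assoc uk' vk' e.
by rewrite (comparison_snd P f) (comparison_snd P f').
Qed.

(** The pair of [k] and [sl_map b ∘ h] induces a map over [x] into the base change of the product of
    [c] and [y]. It respects the actions because [k] identifies whatever [h] does; the preimage of
    this algebra morphism, projected to [c], is the factorization. *)
Lemma full_comparison_strict_epi :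
  fully_faithful (descent_comparison P) ->
  forall b : Slice y, strict_epi (pb_fst (P (sl_map b))).
Proof.
move=> [pf /faithful_comparison_epi pF] b; split=> // c k kh.
have [q [u [v uv]]] := products c y.
pose c' : Slice y := Build_SliceObj v; set h := pb_fst (P (sl_map b)) in kh.
have [l [[ul vl] _]] := uv _ k (sl_map b ∘ h).
have le : v ∘ l = p ∘ pb_snd (P (sl_map b)) by rewrite vl pb_comm.
have lf := pb_fst_lift (P v) le; have ls := pb_snd_lift (P v) le.
set m := pb_lift _ _ in lf ls.
pose K := descent_comparison P; pose T := adj_monad (base_change_adjunction P).
pose m' : carrier (K b) ~> carrier (K c') :=
  @Build_SliceHom C x (carrier (K b)) (carrier (K c')) m ls.
have mA : m' ∘ act (K b) = act (K c') ∘ fmap T m'.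
  have t1 : pb_fst (P _) ∘ sl_hom (fmap T m') = m ∘ pb_fst (P _) := pb_fst_lift _ _.
  have t2 : pb_snd (P _) ∘ sl_hom (fmap T m') = pb_snd (P _) := pb_snd_lift _ _.
  have /= b1 := comparison_act_fst P b; have /= b2 := comparison_act_snd P b.
  have /= c1 := comparison_act_fst P c'; have /= c2 := comparison_act_snd P c'.
  apply/sl_hom_eq; apply: (pb_ext (P := P v)) => /=.
    rewrite (compA_eq lf) (compA_eq c1) -comp_assoc t1 (compA_eq lf).
    have [w [_ wU]] := uv _ (k ∘ pb_fst (P (p ∘ pb_snd (P (sl_map b)))))
      (sl_map b ∘ h ∘ pb_fst (P _)).
    have <- := wU (l ∘ sl_hom (act (K b))).
      by apply: wU; rewrite !comp_assoc ul vl.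
    rewrite !comp_assoc ul vl -!comp_assoc b1; split=> //.
    by apply: kh.
  by rewrite (compA_eq ls) (compA_eq c2) t2 b2.
have [f fE] := pf b c' (@Build_AlgebraHom _ T (K b) (K c') m' mA).
exists (u ∘ sl_hom f); rewrite -comp_assoc -(comparison_fst P f) fE /= lf.
exact: ul.
Qed.

End FullyFaithfulComparison.

Section ElementaryCharacterization.
Variables (C : Category) (products : has_products C) (x y : C) (p : x ~> y).

Lemma almost_descent_epi : almost_descent p -> universally (@epi C) p.
Proof.
move=> [P pF]; apply: (chosen_universally (P := P)).
  by move=> a b c h i j _ hi d g g' e; apply: hi; rewrite !comp_assoc e.
exact: faithful_comparison_epi.
Qed.

Lemma descent_strict_epi : descent p -> universally (@strict_epi C) p.
Proof.
move=> [P pF]; apply: (chosen_universally (P := P)).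
  exact: strict_epi_split.
exact: full_comparison_strict_epi.
Qed.

(** Transported to the chosen pullback, the datum is an algebra [A]. An isomorphism from [A] to some
    [K b] exhibits [a] as a pullback of [b], and [h] is the resulting projection. *)
Lemma effective_descent_effective : effective_descent p -> effective p.
Proof.
move=> [P pE]; have [G [GF _]] := pE; split.
  apply: descent_strict_epi; exists P; split; first exact: equivalence_full.
  exact: equivalence_faithful GF.
move=> a Q q u v xi [pbQ qxi unitQ multQ].
pose K := descent_comparison P; pose T := adj_monad (base_change_adjunction P).
pose a' : Slice x := Build_SliceObj q.
have [i [ui vi]] := pullback_fill pbQ (pb_comm (P _ (p ∘ q))).
have [i' [ui' vi']] := pullback_fill (pb_is_pullback (P _ (p ∘ q))) pbQ.1.
have xim : q ∘ (xi ∘ i) = sl_map (T a') by rewrite comp_assoc qxi.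
pose xi' : T a' ~> a' := @Build_SliceHom C x (T a') a' (xi ∘ i) xim.
have xu : xi' ∘ mon_unit T a' = id a'.
  apply: sl_hom_eq; rewrite /=.
  set eta := pb_lift _ _.
  have e1 : pb_fst (P _ (p ∘ q)) ∘ eta = id _ := pb_fst_lift _ _.
  have e2 : pb_snd (P _ (p ∘ q)) ∘ eta = q := pb_snd_lift _ _.
  rewrite -comp_assoc unitQ ?(compA_eq ui) ?(compA_eq vi) //.
  by rewrite -comp_assoc (compA_eq ui) e1 e2 comp_idr.
have xm : xi' ∘ mon_mult T a' = xi' ∘ fmap T xi'.
  apply: sl_hom_eq; rewrite /=.
  pose mu := sl_hom (mon_mult T a' : T (T a') ~> T a'); pose tx := sl_hom (fmap T xi').
  have m1 : pb_fst (P _ (p ∘ q)) ∘ mu = pb_fst (P _ _) ∘ pb_fst (P _ _) := pb_fst_lift _ _.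
  have m2 : pb_snd (P _ (p ∘ q)) ∘ mu = pb_snd (P _ _) := pb_snd_lift _ _.
  have x1 : pb_fst (P _ (p ∘ q)) ∘ tx = (xi ∘ i) ∘ pb_fst (P _ _) := pb_fst_lift _ _.
  have x2 : pb_snd (P _ (p ∘ q)) ∘ tx = pb_snd (P _ _) := pb_snd_lift _ _.
  rewrite -/mu -/tx -!comp_assoc; symmetry.
  apply: (multQ _ (i ∘ pb_fst (P _ (p ∘ pb_snd (P _ (p ∘ q)))))).
  - by rewrite (compA_eq ui) x1 comp_assoc.
  - by rewrite !(compA_eq ui) m1.
  - by rewrite !(compA_eq vi) m2 x2.
pose A : Desc P := @Build_Algebra _ T a' xi' xu xm.
have [b [f [g [fg gf]]]] := equivalence_essentially_surjective pE A.
pose f1 := sl_hom (alg_hom f); pose g1 := sl_hom (alg_hom g).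
have fg1 : f1 ∘ g1 = id _ := desc_hom_eq fg.
have gf1 : g1 ∘ f1 = id _ := desc_hom_eq gf.
have gm : pb_snd (P _ (sl_map b)) ∘ g1 = q := sl_hom_map (alg_hom g).
have fm : q ∘ f1 = pb_snd (P _ (sl_map b)) := sl_hom_map (alg_hom f).
exists (sl_obj b), (sl_map b), (pb_fst (P _ (sl_map b)) ∘ g1); split.
  apply: is_pullback_intro.
  - by rewrite comp_assoc pb_comm -comp_assoc gm.
  - move=> w s t e.
    have [k [k1 k2]] := pullback_fill (pb_is_pullback (P _ (sl_map b))) e.
    exists (f1 ∘ k); rewrite -!comp_assoc (compA_eq gf1) comp_idl k1.
    by rewrite (compA_eq fm) k2.
  - move=> w r s e1 e2.
    rewrite -[r]comp_idl -[s]comp_idl -fg1 -!comp_assoc; congr (_ ∘ _).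
    by apply: pb_ext; rewrite !comp_assoc // gm.
have [a1 a2 a3] := algebra_hom_act g.
have ii : i ∘ i' = id _.
  by apply: (pullback_joint pbQ); rewrite comp_assoc ?ui ?vi ?ui' ?vi' comp_idr.
pose Tg := sl_hom (fmap T (alg_hom g)).
have gu : pb_fst (P _ _) ∘ Tg = g1 ∘ pb_fst (P _ (p ∘ q)) := a2.
have ga : g1 ∘ (xi ∘ i) = sl_hom (act (K b)) ∘ Tg := a1.
(* As an algebra morphism, [g] carries [xi] to the action of [K b], which agrees with the first
   projection once projected to [b]. *)
rewrite -[xi]comp_idr -ii -!comp_assoc [xi ∘ (i ∘ i')]comp_assoc (compA_eq ga) -comp_assoc.
by rewrite (compA_eq (comparison_act_fst P b)) -comp_assoc (compA_eq gu) -comp_assoc ui'.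
Qed.

End ElementaryCharacterization.

(** * Levelwise structure of T-multicategories *)

Section Levels.
Variables (B : Category) (T : Monad B).

Lemma d0_1_d1_2E (x : PreMulticategory T) : d0_1 x ∘ d1_2 x = d0_1 x ∘ d0_2 x.
Proof. exact: d0_1_d1_2. Qed.

Lemma d1_1_d1_2E (x : PreMulticategory T) :
  d1_1 x ∘ d1_2 x = mon_mult T (ob0 x) ∘ fmap T (d1_1 x) ∘ d2_2 x.
Proof. exact: d1_1_d1_2. Qed.

Lemma ob2_joint (x : PreMulticategory T) w (h k : w ~> ob2 x) :
  d0_2 x ∘ h = d0_2 x ∘ k -> d2_2 x ∘ h = d2_2 x ∘ k -> h = k.
Proof. exact: (pb_ext (P := pb2 x)). Qed.

Lemma d0_2_s0_1 (x : PreMulticategory T) : d0_2 x ∘ s0_1 x = id (ob1 x).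
Proof. exact: pb_fst_lift. Qed.

Lemma d2_2_s0_1 (x : PreMulticategory T) : d2_2 x ∘ s0_1 x = fmap T (s0_0 x) ∘ d1_1 x.
Proof. exact: pb_snd_lift. Qed.

Lemma d0_2_s1_1 (x : PreMulticategory T) : d0_2 x ∘ s1_1 x = s0_0 x ∘ d0_1 x.
Proof. exact: pb_fst_lift. Qed.

Lemma d2_2_s1_1 (x : PreMulticategory T) : d2_2 x ∘ s1_1 x = mon_unit T (ob1 x).
Proof. exact: pb_snd_lift. Qed.

Lemma d0_2_d1_3 (x : PreMulticategory T) : d0_2 x ∘ d1_3 x = d0_2 x ∘ d0_3 x.
Proof. exact: pb_fst_lift. Qed.

Lemma d2_2_d1_3 (x : PreMulticategory T) : d2_2 x ∘ d1_3 x = fmap T (d1_2 x) ∘ d3_3 x.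
Proof. exact: pb_snd_lift. Qed.

Lemma d0_2_d2_3 (x : PreMulticategory T) : d0_2 x ∘ d2_3 x = d1_2 x ∘ d0_3 x.
Proof. exact: pb_fst_lift. Qed.

Lemma d2_2_d2_3 (x : PreMulticategory T) :
  d2_2 x ∘ d2_3 x = mon_mult T (ob1 x) ∘ fmap T (d2_2 x) ∘ d3_3 x.
Proof. exact: pb_snd_lift. Qed.

Lemma map_d0_3 (x y : PreMulticategory T) (p : MCGraphHom x y) :
  d0_3 y ∘ map3 p = map2 p ∘ d0_3 x.
Proof. exact: pb_fst_lift. Qed.

Lemma map_d3_3 (x y : PreMulticategory T) (p : MCGraphHom x y) :
  d3_3 y ∘ map3 p = fmap T (map2 p) ∘ d3_3 x.
Proof. exact: pb_snd_lift. Qed.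

Lemma map2_unique (x y : PreMulticategory T) (p : MCGraphHom x y) (f : ob2 x ~> ob2 y) :
  d0_2 y ∘ f = map1 p ∘ d0_2 x -> d2_2 y ∘ f = fmap T (map1 p) ∘ d2_2 x -> f = map2 p.
Proof. by move=> e1 e2; apply: ob2_joint; rewrite ?map_d0_2 ?map_d2_2. Qed.

Lemma map2_comp (x y z : Multicategory T) (g : MCFunctor y z) (f : MCFunctor x y) :
  map2 (mcf_comp g f) = map2 g ∘ map2 f.
Proof.
symmetry; apply: map2_unique => /=.
  by rewrite comp_assoc map_d0_2 -!comp_assoc map_d0_2.
by rewrite comp_assoc map_d2_2 -!comp_assoc map_d2_2 fmap_comp comp_assoc.
Qed.

Lemma mcf_eq0 (x y : CatT T) (f g : x ~> y) : f = g -> map0 f = map0 g.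
Proof. by move->. Qed.

Lemma mcf_eq1 (x y : CatT T) (f g : x ~> y) : f = g -> map1 f = map1 g.
Proof. by move->. Qed.

(** * Compatibility with degeneracies and faces, and transfer of the axioms *)

Section StructureHom.
Variables (x y : PreMulticategory T) (p : MCGraphHom x y).

(** The remaining conditions of a functor, stated for premulticategories so that they are available
    while the axioms of the source or target are still to be proved. *)
Definition structure_hom : Prop :=
  map1 p ∘ s0_0 x = s0_0 y ∘ map0 p /\ map1 p ∘ d1_2 x = d1_2 y ∘ map2 p.

Hypothesis hp : structure_hom.

Lemma map_s0_1 : map2 p ∘ s0_1 x = s0_1 y ∘ map1 p.
Proof.
apply: ob2_joint; rewrite !comp_assoc ?map_d0_2 ?map_d2_2 -!comp_assoc.
  by rewrite d0_2_s0_1 comp_idr (compA_eq (d0_2_s0_1 y)) comp_idl.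
rewrite d2_2_s0_1 (compA_eq (d2_2_s0_1 y)) -comp_assoc map_d1_1 !comp_assoc.
by rewrite -!fmap_comp hp.1.
Qed.

Lemma map_s1_1 : map2 p ∘ s1_1 x = s1_1 y ∘ map1 p.
Proof.
apply: ob2_joint; rewrite !comp_assoc ?map_d0_2 ?map_d2_2 -!comp_assoc.
  rewrite d0_2_s1_1 (compA_eq (d0_2_s1_1 y)) -comp_assoc map_d0_1 !comp_assoc.
  by rewrite hp.1.
by rewrite d2_2_s1_1 (compA_eq (d2_2_s1_1 y)) (nt_natural (mon_unit T)).
Qed.

Lemma map_d1_3 : map2 p ∘ d1_3 x = d1_3 y ∘ map3 p.
Proof.
apply: ob2_joint; rewrite !comp_assoc ?map_d0_2 ?map_d2_2 -!comp_assoc.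
  rewrite d0_2_d1_3 (compA_eq (d0_2_d1_3 y)) -comp_assoc map_d0_3 !comp_assoc.
  by rewrite map_d0_2.
rewrite d2_2_d1_3 (compA_eq (d2_2_d1_3 y)) -comp_assoc map_d3_3 !comp_assoc.
by rewrite -!fmap_comp hp.2.
Qed.

Lemma map_d2_3 : map2 p ∘ d2_3 x = d2_3 y ∘ map3 p.
Proof.
apply: ob2_joint; rewrite !comp_assoc ?map_d0_2 ?map_d2_2 -!comp_assoc.
  rewrite d0_2_d2_3 (compA_eq (d0_2_d2_3 y)) -comp_assoc map_d0_3 !comp_assoc.
  by rewrite hp.2.
rewrite d2_2_d2_3 (compA_eq (d2_2_d2_3 y)) -!comp_assoc map_d3_3.
rewrite (compA_eq (esym (nt_natural (mon_mult T) (map1 p)))) /= -!comp_assoc.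
congr (_ ∘ _); rewrite !comp_assoc -!fmap_comp.
by rewrite map_d2_2.
Qed.

End StructureHom.

Definition multicategory_axioms (x : PreMulticategory T) : Prop :=
  [/\ d1_2 x ∘ s0_1 x = id (ob1 x), d1_2 x ∘ s1_1 x = id (ob1 x)
    & d1_2 x ∘ d1_3 x = d1_2 x ∘ d2_3 x].

(** The axioms are equations between maps into x_1, so a jointly monic pair reflects them. This
    serves for pullbacks, with their two projections. *)
Lemma multicategory_joint (x : PreMulticategory T) (y y' : Multicategory T)
    (p : MCGraphHom x y) (p' : MCGraphHom x y') :
  structure_hom p -> structure_hom p' ->
  (forall w (h k : w ~> ob1 x),
     map1 p ∘ h = map1 p ∘ k -> map1 p' ∘ h = map1 p' ∘ k -> h = k) ->
  multicategory_axioms x.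
Proof.
move=> hp hp' joint; split.
- apply: joint; rewrite comp_assoc ?hp.2 ?hp'.2 -comp_assoc map_s0_1 // comp_assoc mc_unitl;
  by rewrite comp_idl comp_idr.
- apply: joint; rewrite comp_assoc ?hp.2 ?hp'.2 -comp_assoc map_s1_1 // comp_assoc mc_unitr;
  by rewrite comp_idl comp_idr.
- apply: joint; rewrite !comp_assoc ?hp.2 ?hp'.2 -!comp_assoc map_d1_3 // map_d2_3 //;
  by rewrite !comp_assoc mc_assoc.
Qed.

(** Dually, the axioms are equations between maps out of y_1 and, for associativity, out of y_3, so
    they pass along maps that are epimorphisms at these levels. *)
Lemma multicategory_epi (x : Multicategory T) (y : PreMulticategory T) (h : MCGraphHom x y) :
  structure_hom h -> epi (map1 h) -> epi (map3 h) ->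
  multicategory_axioms y.
Proof.
move=> hh h1 h3; split.
- apply: h1; rewrite -comp_assoc -map_s0_1 // comp_assoc -hh.2 -comp_assoc mc_unitl.
  by rewrite comp_idl comp_idr.
- apply: h1; rewrite -comp_assoc -map_s1_1 // comp_assoc -hh.2 -comp_assoc mc_unitr.
  by rewrite comp_idl comp_idr.
- apply: h3; rewrite -!comp_assoc -map_d1_3 // -map_d2_3 // !comp_assoc -hh.2.
  by rewrite -!comp_assoc mc_assoc.
Qed.

Hypothesis hT : preserves_pullbacks T.

(** * Pullbacks of multicategories, level by level *)

Section GraphSquares.
Variables (a b x z : PreMulticategory T).
Variables (n : MCGraphHom b z) (p : MCGraphHom x z) (h : MCGraphHom a b) (q : MCGraphHom a x).
Hypothesis (pb_1 : is_pullback (map1 n) (map1 p) (map1 h) (map1 q)).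

Lemma map2_pullback :
  is_pullback (map0 n) (map0 p) (map0 h) (map0 q) ->
  is_pullback (map2 n) (map2 p) (map2 h) (map2 q).
Proof.
move=> pb_0; apply: (pullback_of_pullbacks (pb_is_pullback (pb2 a)) (pb_is_pullback (pb2 b))
  (pb_is_pullback (pb2 x)) (pb_is_pullback (pb2 z)) pb_1 (hT pb_1) (hT pb_0));
rewrite -?fmap_comp ?map_d1_1 ?map_d0_1 //;
by [exact: map_d0_2 | exact: map_d2_2].
Qed.

Lemma map3_pullback :
  is_pullback (map2 n) (map2 p) (map2 h) (map2 q) ->
  is_pullback (map3 n) (map3 p) (map3 h) (map3 q).
Proof.
move=> pb_2; apply: (pullback_of_pullbacks (pb_is_pullback (pb3 a)) (pb_is_pullback (pb3 b))
  (pb_is_pullback (pb3 x)) (pb_is_pullback (pb3 z)) pb_2 (hT pb_2) (hT pb_1));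
rewrite -?fmap_comp -?[pb_fst (pb2 _)]/(d0_2 _) -?[pb_snd (pb2 _)]/(d2_2 _) ?map_d2_2 ?map_d0_2 //;
by [exact: map_d0_3 | exact: map_d3_3].
Qed.

End GraphSquares.

Lemma levelwise_pullback (a b x z : CatT T) (n : b ~> z) (p : x ~> z) (h : a ~> b) (q : a ~> x) :
  is_pullback (map0 n) (map0 p) (map0 h) (map0 q) ->
  is_pullback (map1 n) (map1 p) (map1 h) (map1 q) ->
  is_pullback n p h q.
Proof.
move=> pb_0 pb_1; apply: is_pullback_intro.
- by apply: mcf_eq; [apply: pb_0.1 | apply: pb_1.1].
- move=> w s t e.
  have [m0 [hm0 qm0]] := pullback_fill pb_0 (mcf_eq0 e).
  have [m1 [hm1 qm1]] := pullback_fill pb_1 (mcf_eq1 e).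
  have md0 : d0_1 a ∘ m1 = m0 ∘ d0_1 w.
    apply: (pullback_joint pb_0).
      by rewrite !comp_assoc -map_d0_1 -comp_assoc hm0 hm1 map_d0_1.
    by rewrite !comp_assoc -map_d0_1 -comp_assoc qm0 qm1 map_d0_1.
  (* The codomain is [T] of level 0, which is a pullback by [hT]. *)
  have md1 : d1_1 a ∘ m1 = fmap T m0 ∘ d1_1 w.
    apply: (pullback_joint (hT pb_0)).
      by rewrite !comp_assoc -map_d1_1 -comp_assoc -fmap_comp hm0 hm1 map_d1_1.
    by rewrite !comp_assoc -map_d1_1 -comp_assoc -fmap_comp qm0 qm1 map_d1_1.
  pose m := {| map0 := m0; map1 := m1; map_d0_1 := md0; map_d1_1 := md1 |}.
  have hm2 : map2 h ∘ map2 m = map2 s.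
    apply: map2_unique; rewrite comp_assoc ?map_d0_2 ?map_d2_2 -comp_assoc ?map_d0_2 ?map_d2_2.
      by rewrite comp_assoc hm1.
    by rewrite comp_assoc -fmap_comp hm1.
  have qm2 : map2 q ∘ map2 m = map2 t.
    apply: map2_unique; rewrite comp_assoc ?map_d0_2 ?map_d2_2 -comp_assoc ?map_d0_2 ?map_d2_2.
      by rewrite comp_assoc qm1.
    by rewrite comp_assoc -fmap_comp qm1.
  have ms0 : map1 m ∘ s0_0 w = s0_0 a ∘ map0 m.
    apply: (pullback_joint pb_1) => /=.
      by rewrite !comp_assoc hm1 !map_s0_0 -comp_assoc hm0.
    by rewrite !comp_assoc qm1 !map_s0_0 -comp_assoc qm0.
  have md1_2 : map1 m ∘ d1_2 w = d1_2 a ∘ map2 m.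
    apply: (pullback_joint pb_1) => /=.
      by rewrite !comp_assoc hm1 !map_d1_2 -comp_assoc hm2.
    by rewrite !comp_assoc qm1 !map_d1_2 -comp_assoc qm2.
  exists (Build_MCFunctor ms0 md1_2).
  by split; apply: mcf_eq.
- move=> w r s e1 e2; apply: mcf_eq.
    apply: (pullback_joint pb_0).
      exact: (mcf_eq0 e1).
    exact: (mcf_eq0 e2).
  apply: (pullback_joint pb_1).
    exact: (mcf_eq1 e1).
  exact: (mcf_eq1 e2).
Qed.

Hypothesis hB : has_finite_limits B.

(** Pullbacks at levels 0 and 1 inherit the structure maps; [T P0] is again a pullback, so d_1 is
    induced too, and the axioms hold because the projections at level 1 are jointly monic. *)
Lemma multicategory_pullback (w x z : CatT T) (f : w ~> z) (p : x ~> z) :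
  exists (P : CatT T) (u : P ~> w) (v : P ~> x),
    is_pullback (map0 f) (map0 p) (map0 u) (map0 v) /\
    is_pullback (map1 f) (map1 p) (map1 u) (map1 v).
Proof.
have [[P0 u0 v0 pb_0] _] := finite_limits_pullback hB (map0 f) (map0 p).
have [[P1 u1 v1 pb_1] _] := finite_limits_pullback hB (map1 f) (map1 p).
have Tpb_0 := hT pb_0.
have [d0 [ud0 vd0]] : exists d0 : P1 ~> P0, u0 ∘ d0 = d0_1 w ∘ u1 /\ v0 ∘ d0 = d0_1 x ∘ v1.
  apply: (pullback_fill pb_0).
  by rewrite !comp_assoc -!map_d0_1 -!comp_assoc pb_1.1.
have [d1 [ud1 vd1]] : exists d1 : P1 ~> T P0,
    fmap T u0 ∘ d1 = d1_1 w ∘ u1 /\ fmap T v0 ∘ d1 = d1_1 x ∘ v1.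
  apply: (pullback_fill Tpb_0).
  by rewrite !comp_assoc -!map_d1_1 -!comp_assoc pb_1.1.
have [P2 _] := finite_limits_pullback hB d1 (fmap T d0).
have [u2 [u2f u2s]] : exists u2 : P2 ~> ob2 w,
    d0_2 w ∘ u2 = u1 ∘ pb_fst P2 /\ d2_2 w ∘ u2 = fmap T u1 ∘ pb_snd P2.
  apply: (pullback_fill (pb_is_pullback (pb2 w))).
  by rewrite !comp_assoc -ud1 -fmap_comp -ud0 fmap_comp -!comp_assoc pb_comm.
have [v2 [v2f v2s]] : exists v2 : P2 ~> ob2 x,
    d0_2 x ∘ v2 = v1 ∘ pb_fst P2 /\ d2_2 x ∘ v2 = fmap T v1 ∘ pb_snd P2.
  apply: (pullback_fill (pb_is_pullback (pb2 x))).
  by rewrite !comp_assoc -vd1 -fmap_comp -vd0 fmap_comp -!comp_assoc pb_comm.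
have [d12 [ud12 vd12]] : exists d12 : P2 ~> P1, u1 ∘ d12 = d1_2 w ∘ u2 /\ v1 ∘ d12 = d1_2 x ∘ v2.
  apply: (pullback_fill pb_1).
  rewrite !comp_assoc !map_d1_2 -!comp_assoc; congr (_ ∘ _).
  apply: ob2_joint; rewrite !comp_assoc ?map_d0_2 ?map_d2_2 -!comp_assoc.
    by rewrite u2f v2f !comp_assoc pb_1.1.
  by rewrite u2s v2s !comp_assoc -!fmap_comp pb_1.1.
have e1 : d1 ∘ d12 = mon_mult T P0 ∘ fmap T d1 ∘ pb_snd P2.
  apply: (pullback_joint Tpb_0).
    rewrite comp_assoc ud1 -comp_assoc ud12 comp_assoc d1_1_d1_2E -!comp_assoc u2s.
    rewrite (compA_eq (esym (nt_natural (mon_mult T) u0))) /= -comp_assoc; congr (_ ∘ _).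
    by rewrite !comp_assoc -!fmap_comp ud1.
  rewrite comp_assoc vd1 -comp_assoc vd12 comp_assoc d1_1_d1_2E -!comp_assoc v2s.
  rewrite (compA_eq (esym (nt_natural (mon_mult T) v0))) /= -comp_assoc; congr (_ ∘ _).
  by rewrite !comp_assoc -!fmap_comp vd1.
have e2 : d0 ∘ d12 = d0 ∘ pb_fst P2.
  apply: (pullback_joint pb_0).
    by rewrite !comp_assoc ud0 -!comp_assoc ud12 comp_assoc d0_1_d1_2E -comp_assoc u2f.
  by rewrite !comp_assoc vd0 -!comp_assoc vd12 comp_assoc d0_1_d1_2E -comp_assoc v2f.
have [s0 [us0 vs0]] : exists s0 : P0 ~> P1, u1 ∘ s0 = s0_0 w ∘ u0 /\ v1 ∘ s0 = s0_0 x ∘ v0.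
  apply: (pullback_fill pb_1).
  by rewrite !comp_assoc !map_s0_0 -!comp_assoc pb_0.1.
have e3 : d1 ∘ s0 = mon_unit T P0.
  apply: (pullback_joint Tpb_0).
    rewrite comp_assoc ud1 -comp_assoc us0 comp_assoc d1_1_s0_0.
    exact: (nt_natural (mon_unit T) u0).
  rewrite comp_assoc vd1 -comp_assoc vs0 comp_assoc d1_1_s0_0.
  exact: (nt_natural (mon_unit T) v0).
have e4 : d0 ∘ s0 = id P0.
  apply: (pullback_joint pb_0).
    by rewrite comp_assoc ud0 -comp_assoc us0 comp_assoc d0_1_s0_0 comp_idl comp_idr.
  by rewrite comp_assoc vd0 -comp_assoc vs0 comp_assoc d0_1_s0_0 comp_idl comp_idr.
have [P3 _] := finite_limits_pullback hB (pb_snd P2) (fmap T (pb_fst P2)).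
pose P := Build_PreMulticategory e1 e2 e3 e4 P3.
pose u : MCGraphHom P w := @Build_MCGraphHom _ _ P w u0 u1 (esym ud0) (esym ud1).
pose v : MCGraphHom P x := @Build_MCGraphHom _ _ P x v0 v1 (esym vd0) (esym vd1).
have hu : structure_hom u.
  by split=> //; rewrite /= ud12; congr (_ ∘ _); apply: (map2_unique (p := u)).
have hv : structure_hom v.
  by split=> //; rewrite /= vd12; congr (_ ∘ _); apply: (map2_unique (p := v)).
have [a1 a2 a3] := multicategory_joint hu hv (@pullback_joint _ _ _ _ _ _ _ _ _ pb_1).
pose X := Build_Multicategory a1 a2 a3.
by exists X, (@Build_MCFunctor _ _ X w u hu.1 hu.2), (@Build_MCFunctor _ _ X x v hv.1 hv.2).
Qed.

(** Any pullback in [CatT T] is isomorphic to the one built levelwise. *)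
Lemma pullback_levels (a b x z : CatT T) (n : b ~> z) (p : x ~> z) (h : a ~> b) (q : a ~> x) :
  is_pullback n p h q ->
  is_pullback (map0 n) (map0 p) (map0 h) (map0 q) /\
  is_pullback (map1 n) (map1 p) (map1 h) (map1 q).
Proof.
move=> pb; have [P [u [v [pb_0 pb_1]]]] := multicategory_pullback n p.
have pb' := levelwise_pullback pb_0 pb_1.
have [i [ui vi]] := pullback_fill pb' pb.1; have [j [hj qj]] := pullback_fill pb pb'.1.
have ji : j ∘ i = id a.
  by apply: (pullback_joint pb); rewrite comp_assoc ?hj ?qj ?ui ?vi comp_idr.
have ij : i ∘ j = id P.
  by apply: (pullback_joint pb'); rewrite comp_assoc ?ui ?vi ?hj ?qj comp_idr.
split.
- apply: (pullback_iso (i := map0 i) (j := map0 j) _ _ _ _ pb_0).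
  + exact: (mcf_eq0 ui).
  + exact: (mcf_eq0 vi).
  + exact: (mcf_eq0 ji).
  + exact: (mcf_eq0 ij).
- apply: (pullback_iso (i := map1 i) (j := map1 j) _ _ _ _ pb_1).
  + exact: (mcf_eq1 ui).
  + exact: (mcf_eq1 vi).
  + exact: (mcf_eq1 ji).
  + exact: (mcf_eq1 ij).
Qed.

End Levels.

(** * Effective descent for multicategory functors *)

Section MulticategoryDescent.
Variables (B : Category) (T : Monad B).
Hypothesis (hT : preserves_pullbacks T) (hB : has_finite_limits B).

(* [map0] is a retract of [map1] along the identities [s0_0]. *)
Lemma map0_from_map1 (x y : CatT T) (f : x ~> y) : map0 f = d0_1 y ∘ (map1 f ∘ s0_0 x).
Proof. by rewrite map_s0_0 comp_assoc d0_1_s0_0 comp_idl. Qed.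

Lemma map0_epi (x y : CatT T) (h : x ~> y) : epi (map1 h) -> epi (map0 h).
Proof.
move=> h1 c g g' e.
have : g ∘ d0_1 y = g' ∘ d0_1 y.
  by apply: h1; rewrite -!comp_assoc map_d0_1 !comp_assoc e.
by move=> /(f_equal (fun k => k ∘ s0_0 y)); rewrite -!comp_assoc d0_1_s0_0 !comp_idr.
Qed.

Lemma multicategory_epi_levels (x y : CatT T) (h : x ~> y) : epi (map1 h) -> epi h.
Proof.
move=> h1 c g g' e.
have e1 : map1 g = map1 g' by apply: h1; apply: (mcf_eq1 e).
by apply: mcf_eq => //; rewrite map0_from_map1 e1 -map0_from_map1.
Qed.

Lemma multicategory_strict_epi (a b : CatT T) (h : a ~> b) :
  strict_epi (map1 h) -> epi (map2 h) -> strict_epi h.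
Proof.
move=> [h1 h1S] h2; split; first exact: multicategory_epi_levels.
have h0 := map0_epi h1.
(* The kernel pair is formed in [CatT T], where [hk] applies; its level 1 is the kernel pair of
   [map1 h], so [map1 k] identifies all that [map1 h] does. *)
move=> c k hk; have [P [r [s [pb_0 pb_1]]]] := multicategory_pullback hT hB h h.
have krs := hk _ r s (levelwise_pullback hT pb_0 pb_1).1.
have [|g1 g1E] := h1S _ (map1 k).
  move=> w t t' /(pullback_fill pb_1) [m [<- <-]].
  by rewrite !comp_assoc; congr (_ ∘ _); apply: (mcf_eq1 krs).
(* The only candidate, by [map0_from_map1]. *)
pose g0 := d0_1 c ∘ (g1 ∘ s0_0 b).
have g0E : g0 ∘ map0 h = map0 k.
  by rewrite (map0_from_map1 k) -g1E /g0 -!comp_assoc -map_s0_0.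
clearbody g0.
have gd0 : d0_1 c ∘ g1 = g0 ∘ d0_1 b.
  apply: h1; rewrite -!comp_assoc map_d0_1 g1E map_d0_1.
  by rewrite (compA_eq g0E).
have gd1 : d1_1 c ∘ g1 = fmap T g0 ∘ d1_1 b.
  apply: h1; rewrite -!comp_assoc map_d1_1 g1E map_d1_1.
  by rewrite comp_assoc -fmap_comp g0E.
pose g : MCGraphHom b c := Build_MCGraphHom gd0 gd1.
have g1h : map1 g ∘ map1 h = map1 k := g1E.
have g2E : map2 g ∘ map2 h = map2 k.
  apply: map2_unique.
    by rewrite comp_assoc map_d0_2 -comp_assoc map_d0_2 comp_assoc g1E.
  by rewrite comp_assoc map_d2_2 -comp_assoc map_d2_2 comp_assoc -fmap_comp g1E.
have gs : map1 g ∘ s0_0 b = s0_0 c ∘ map0 g.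
  by apply: h0; rewrite -!comp_assoc -map_s0_0 comp_assoc g1h g0E map_s0_0.
have gd : map1 g ∘ d1_2 b = d1_2 c ∘ map2 g.
  by apply: h2; rewrite -!comp_assoc -map_d1_2 [LHS]comp_assoc g1h g2E map_d1_2.
by exists (Build_MCFunctor gs gd); apply: mcf_eq.
Qed.

(** The hypothesis speaks of elements in [CatT T], and an element of level 1 of [P] in [B] need not
    come from one. It is therefore applied to universal elements: the unit [eta], and [tx] and [mu]
    out of the twofold pullback [PP]. Pullbacks being levelwise, the elements to be tested in [B]
    factor through level 1 of these. *)
Lemma descent_datum_level1 (x z a P : CatT T) (p : x ~> z) (q : a ~> x)
    (u : P ~> a) (v : P ~> x) (xi : P ~> a) :
  descent_datum p q u v xi -> descent_datum (map1 p) (map1 q) (map1 u) (map1 v) (map1 xi).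
Proof.
move=> [pbP qxi unitP multP].
have [pbP_0 pbP_1] := pullback_levels hT hB pbP.
have [PP [u' [v' [pb'_0 pb'_1]]]] := multicategory_pullback hT hB (p ∘ v) p.
have pb' := levelwise_pullback hT pb'_0 pb'_1.
have qx1 : map1 q ∘ map1 xi = map1 v := mcf_eq1 qxi.
split=> //.
- move=> w r e.
  have [eta [ueta veta]] := pullback_fill pbP (s := id a) (t := q) (comp_idr _).
  have u1 : map1 u ∘ map1 eta = id _ := mcf_eq1 ueta.
  have v1 : map1 v ∘ map1 eta = map1 q := mcf_eq1 veta.
  have xeta : xi ∘ eta = u ∘ eta by apply: unitP; rewrite veta -comp_assoc ueta comp_idr.
  have x1 : map1 xi ∘ map1 eta = id _ := mcf_eq1 (etrans xeta ueta).
  have -> : r = map1 eta ∘ (map1 u ∘ r).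
    apply: (pullback_joint pbP_1); first by rewrite (compA_eq u1) comp_idl.
    by rewrite (compA_eq v1) e comp_assoc.
  by rewrite (compA_eq x1) (compA_eq u1).
- move=> w s t t' e1 e2 e3.
  have [mu [umu vmu]] : exists mu : PP ~> P, u ∘ mu = u ∘ u' /\ v ∘ mu = v'.
    by apply: (pullback_fill pbP); rewrite -pb'.1 !comp_assoc pbP.1.
  have [tx [utx vtx]] : exists tx : PP ~> P, u ∘ tx = xi ∘ u' /\ v ∘ tx = v'.
    by apply: (pullback_fill pbP); rewrite -pb'.1 -!comp_assoc (compA_eq qxi).
  have xmu : map1 xi ∘ map1 tx = map1 xi ∘ map1 mu.
    by apply: (mcf_eq1 (f := xi ∘ tx) (g := xi ∘ mu)); apply: (multP _ u'); rewrite ?vmu.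
  have [m [um vm]] : exists m, map1 u' ∘ m = s /\ map1 v' ∘ m = map1 v ∘ t.
    apply: (pullback_fill pb'_1) => /=.
    by rewrite [RHS]comp_assoc -[in RHS]pbP_1.1 /= -!comp_assoc e1 (compA_eq qx1).
  have <- : map1 tx ∘ m = t.
    apply: (pullback_joint pbP_1); rewrite comp_assoc.
      have -> : map1 u ∘ map1 tx = map1 xi ∘ map1 u' := mcf_eq1 utx.
      by rewrite -comp_assoc um.
    by have -> : map1 v ∘ map1 tx = map1 v' := mcf_eq1 vtx.
  have <- : map1 mu ∘ m = t'.
    apply: (pullback_joint pbP_1); rewrite comp_assoc.
      have -> : map1 u ∘ map1 mu = map1 u ∘ map1 u' := mcf_eq1 umu.
      by rewrite -comp_assoc um.
    have -> : map1 v ∘ map1 mu = map1 v' := mcf_eq1 vmu.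
    by rewrite vm.
  by rewrite !comp_assoc xmu.
Qed.

Lemma multicategory_effective (x z : CatT T) (p : x ~> z) :
  effective (map1 p) -> universally (@strict_epi B) (map2 p) ->
  universally (@epi B) (map3 p) -> effective p.
Proof.
move=> [p1S p1E] p2S p3S; split.
  move=> a b n h q pb; have [pb_0 pb_1] := pullback_levels hT hB pb.
  apply: multicategory_strict_epi; first exact: p1S pb_1.
  by case: (p2S _ _ _ _ _ (map2_pullback hT pb_1 pb_0)).
move=> a P q u v xi dd; have [pbP qxi _ _] := dd.
have [pbP_0 pbP_1] := pullback_levels hT hB pbP.
have pbP_2 := map2_pullback hT pbP_1 pbP_0.
have [b1 [n1 [h1 [pb_1 h1xi]]]] := p1E _ _ _ _ _ _ (descent_datum_level1 dd).
have h1S := p1S _ _ _ _ _ pb_1; have [h1epi _] := h1S.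
have q1xi : map1 q ∘ map1 xi = map1 v := mcf_eq1 qxi.
have factor c (k : ob1 a ~> c) : k ∘ map1 xi = k ∘ map1 u -> exists g, g ∘ h1 = k.
  exact: effective_factor h1S pb_1 pbP_1 q1xi h1xi.
have [e eE] : exists e, e ∘ h1 = h1 ∘ (s0_0 a ∘ d0_1 a).
  apply: factor; rewrite -!comp_assoc !map_d0_1.
  by rewrite !(compA_eq (esym (map_s0_0 _))) !comp_assoc h1xi.
have ee : e ∘ e = e.
  apply: h1epi; rewrite -comp_assoc eE (compA_eq eE) -!comp_assoc.
  by rewrite (compA_eq (d0_1_s0_0 a)) comp_idl.
(* [d0] and [i] become d_0 and s_0 of the quotient, so that [d0i] is the law d_0 s_0 = id. *)
have [b0 [i [d0 [d0i id0]]]] := finite_limits_split hB ee.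
(* Forced by [map0_from_map1], as is [n0] below. *)
pose h0 := d0 ∘ (h1 ∘ s0_0 a).
have d0h : d0 ∘ h1 = h0 ∘ d0_1 a.
  have d0e : d0 ∘ e = d0 by rewrite -id0 comp_assoc d0i comp_idl.
  by rewrite -{1}d0e -comp_assoc eE /h0 !comp_assoc.
have ih : i ∘ h0 = h1 ∘ s0_0 a.
  by rewrite /h0 comp_assoc id0 comp_assoc eE -!comp_assoc d0_1_s0_0 comp_idr.
clearbody h0.
have h0epi : epi h0.
  move=> c g g' e'; have : g ∘ d0 = g' ∘ d0.
    by apply: h1epi; rewrite -!comp_assoc d0h !comp_assoc e'.
  by move=> /(f_equal (fun k => k ∘ i)); rewrite -!comp_assoc d0i !comp_idr.
pose n0 := d0_1 z ∘ (n1 ∘ i).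
have n0h : n0 ∘ h0 = map0 p ∘ map0 q.
  rewrite /n0 -!comp_assoc ih (compA_eq pb_1.1) -comp_assoc map_s0_0.
  by rewrite (compA_eq (map_s0_0 p)) -comp_assoc (compA_eq (d0_1_s0_0 z)) comp_idl.
clearbody n0.
have nd0 : d0_1 z ∘ n1 = n0 ∘ d0.
  apply: h1epi; rewrite -!comp_assoc d0h (compA_eq n0h) pb_1.1.
  by rewrite comp_assoc map_d0_1 -!comp_assoc map_d0_1.
have ns0 : n1 ∘ i = s0_0 z ∘ n0.
  apply: h0epi; rewrite -!comp_assoc ih n0h (compA_eq pb_1.1) -comp_assoc map_s0_0.
  by rewrite !comp_assoc map_s0_0.
(* The square of objects is a retract of the square of arrows, through s_0 and d_0. *)
have pb_0 : is_pullback n0 (map0 p) h0 (map0 q).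
  apply: (pullback_retract (d0_1_s0_0 a) d0i (d0_1_s0_0 x) (esym ih) (map_s0_0 q) ns0
    (map_s0_0 p) (esym d0h) (esym (map_d0_1 q)) n0h pb_1).
have h0xi : h0 ∘ map0 xi = h0 ∘ map0 u.
  rewrite (map0_from_map1 xi) (map0_from_map1 u) !(compA_eq (esym d0h)).
  by rewrite -!comp_assoc (compA_eq h1xi) -comp_assoc.
(* d_1 carries the action at level 1 to [T] of the action at level 0, which [fmap T h0] coequalizes
   with the projection by [h0xi]. *)
have [d1 d1h] : exists d1 : b1 ~> T b0, d1 ∘ h1 = fmap T h0 ∘ d1_1 a.
  apply: factor; rewrite -!comp_assoc !map_d1_1 !comp_assoc.
  by rewrite -!fmap_comp h0xi.
have nd1 : d1_1 z ∘ n1 = fmap T n0 ∘ d1.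
  apply: h1epi; rewrite -!comp_assoc pb_1.1 d1h !comp_assoc map_d1_1 -fmap_comp n0h.
  by rewrite -comp_assoc map_d1_1 fmap_comp comp_assoc.
have d1i : d1 ∘ i = mon_unit T b0.
  apply: h0epi; rewrite -comp_assoc ih (compA_eq d1h) -comp_assoc d1_1_s0_0.
  by rewrite (nt_natural (mon_unit T) h0).
have [b2 _] := finite_limits_pullback hB d1 (fmap T d0).
have [h2 [h2f h2s]] : exists h2 : ob2 a ~> b2,
    pb_fst b2 ∘ h2 = h1 ∘ d0_2 a /\ pb_snd b2 ∘ h2 = fmap T h1 ∘ d2_2 a.
  apply: (pullback_fill (pb_is_pullback b2)).
  by rewrite (compA_eq d1h) -comp_assoc pb2_comm !comp_assoc -!fmap_comp d0h.
have [n2 [n2f n2s]] : exists n2 : b2 ~> ob2 z,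
    d0_2 z ∘ n2 = n1 ∘ pb_fst b2 /\ d2_2 z ∘ n2 = fmap T n1 ∘ pb_snd b2.
  apply: (pullback_fill (pb_is_pullback (pb2 z))).
  by rewrite (compA_eq nd1) -comp_assoc pb_comm !comp_assoc -!fmap_comp nd0.
(* The quotient still lacks its composition, so [map2_pullback] cannot be applied to it; the square
   is assembled directly from levels 0 and 1. *)
have pb_2 : is_pullback n2 (map2 p) h2 (map2 q).
  apply: (pullback_of_pullbacks (pb_is_pullback (pb2 a)) (pb_is_pullback b2)
    (pb_is_pullback (pb2 x)) (pb_is_pullback (pb2 z)) pb_1 (hT pb_1) (hT pb_0));
  rewrite -?fmap_comp ?map_d1_1 ?map_d0_1 ?d1h ?d0h //;
  by [exact: map_d0_2 | exact: map_d2_2].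
have h2S := p2S _ _ _ _ _ pb_2.
have h2xi : h2 ∘ map2 xi = h2 ∘ map2 u.
  apply: pb_ext; rewrite !comp_assoc ?h2f ?h2s -!comp_assoc ?map_d0_2 ?map_d2_2 !comp_assoc.
    by rewrite h1xi.
  by rewrite -!fmap_comp h1xi.
have pbP_2' : is_pullback (map2 p ∘ map2 q) (map2 p) (map2 u) (map2 v).
  by rewrite -map2_comp.
have q2xi : map2 q ∘ map2 xi = map2 v.
  by rewrite -map2_comp; congr (map2 (mcf_graph _)); exact: qxi.
have [d12 d12h] : exists d12 : b2 ~> b1, d12 ∘ h2 = h1 ∘ d1_2 a.
  apply: (effective_factor h2S pb_2 pbP_2' q2xi h2xi).
  by rewrite -!comp_assoc -!map_d1_2 !comp_assoc h1xi.
have [h2epi _] := h2S.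
have e1 : d1 ∘ d12 = mon_mult T b0 ∘ fmap T d1 ∘ pb_snd b2.
  apply: h2epi; rewrite -!comp_assoc d12h (compA_eq d1h) -comp_assoc d1_1_d1_2E h2s.
  rewrite -comp_assoc (compA_eq (esym (nt_natural (mon_mult T) h0))) /= -comp_assoc.
  by congr (_ ∘ _); rewrite !comp_assoc -!fmap_comp d1h.
have e2 : d0 ∘ d12 = d0 ∘ pb_fst b2.
  apply: h2epi; rewrite -!comp_assoc d12h h2f !(compA_eq d0h) -!comp_assoc.
  by rewrite d0_1_d1_2E.
have [b3 _] := finite_limits_pullback hB (pb_snd b2) (fmap T (pb_fst b2)).
pose b := Build_PreMulticategory e1 e2 d1i d0i b3.
pose h : MCGraphHom a b := @Build_MCGraphHom _ _ a b h0 h1 d0h d1h.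
pose n : MCGraphHom b z := @Build_MCGraphHom _ _ b z n0 n1 nd0 nd1.
have h2E : h2 = map2 h by apply: (map2_unique (p := h)).
have n2E : n2 = map2 n by apply: (map2_unique (p := n)).
have hh : structure_hom h by split; rewrite /= -?h2E.
have hn : structure_hom n.
  split=> //=; apply: h2epi.
  rewrite -!comp_assoc d12h -n2E pb_2.1 !comp_assoc pb_1.1 -map_d1_2.
  by rewrite -!comp_assoc -map_d1_2.
have pb_2' : is_pullback (map2 n) (map2 p) (map2 h) (map2 q) by rewrite -h2E -n2E.
have h3epi : epi (map3 h) := p3S _ _ _ _ _ (map3_pullback (n := n) (h := h) hT pb_1 pb_2').
have [a1 a2 a3] := multicategory_epi hh h1epi h3epi.
pose b' := Build_Multicategory a1 a2 a3.
pose n' := @Build_MCFunctor _ _ b' z n hn.1 hn.2.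
pose h' := @Build_MCFunctor _ _ a b' h hh.1 hh.2.
exists b', n', h'; split; last exact: mcf_eq.
exact: (@levelwise_pullback _ _ hT a b' x z n' p h' q).
Qed.

End MulticategoryDescent.

Theorem theorem4p5 (B : Category) (hB : has_finite_limits B)
    (T : Monad B) (hT : cartesian_monad T)
    (x z : CatT T) (p : x ~> z)
    (hp1 : effective_descent (fmap T (map1 p)))
    (hp2 : descent (fmap T (map2 p)))
    (hp3 : almost_descent (map3 p)) :
  effective_descent p.
Proof.
have [Tpb _ unit_cartesian] := hT; have prodB := finite_limits_products hB.
have P0 (w : CatT T) (f : w ~> z) : exists P : Pullback f p, True.
  have [P [u [v [pb_0 pb_1]]]] := multicategory_pullback Tpb hB f p.
  by exists (Build_Pullback (levelwise_pullback Tpb pb_0 pb_1)).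
(* The definition asks for a choice of pullbacks; [effective] mentions none, so any choice will
   do. *)
pose P : pullbacks_along p := fun w f => proj1_sig (constructive_indefinite_description _ (P0 w f)).
exists P; apply/effective_comparison/(multicategory_effective Tpb hB).
- apply: (effective_pullback (unit_cartesian _ _ (map1 p))).
  exact (effective_descent_effective prodB hp1).
- apply: (universally_pullback (unit_cartesian _ _ (map2 p))).
  exact (descent_strict_epi prodB hp2).
- exact (almost_descent_epi prodB hp3).
Qed.
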